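(* Let $G=\{G_n\}_{n\in\mathbb{N}}$ be an ordered mean, $\mathbf{A}\in\mathbb{P}^n$, $\omega\in\Delta_n$, $p\in[-1,1]$ and $\mu,\nu>0$. Then the two families $$\{G^{P_p(1-t,t;\mu,\nu)}(\omega;\mathbf{A})\}_{t\in[0,1]},\qquad \{P_p(1-t,t;G^\mu(\omega;\mathbf{A}),G^\nu(\omega;\mathbf{A}))\}_{t\in[0,1]}$$ interpolate monotonically between $G^\mu(\omega;\mathbf{A})$ and $G^\nu(\omega;\mathbf{A})$: both equal $G^\mu(\omega;\mathbf{A})$ at $t=0$ and $G^\nu(\omega;\mathbf{A})$ at $t=1$, and, with respect to the Loewner order, both are monotonically increasing in $t\in[0,1]$ if $\mu\le\nu$ and monotonically decreasing in $t\in[0,1]$ if $\nu\le\mu$.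
   Context: Let $\mathcal{H}$ be a Hilbert space and $\mathbb{P}$ the open convex cone of positive invertible bounded linear operators on $\mathcal{H}$; $I$ is the identity. For self-adjoint $A,B$, $A\le B$ means $B-A$ is positive semi-definite (Loewner order); monotonicity is in the non-strict sense. $\Delta_n$ is the set of probability vectors $\omega=(w_1,\dots,w_n)\in\mathbb{R}^n$ with all $w_i>0$ and $\sum_i w_i=1$. An ordered mean is a family $G=\{G_n\}_{n\in\mathbb{N}}$ of maps $G_n:\Delta_n\times\mathbb{P}^n\to\mathbb{P}$ such that for every $n$, all $\mathbf{A},\mathbf{B}\in\mathbb{P}^n$, $\omega\in\Delta_n$ and real $a>0$: (P1) $G_n(\omega;a\mathbf{A})=aG_n(\omega;\mathbf{A})$; (P2) $G_n(\omega;\mathbf{B})\le G_n(\omega;\mathbf{A})$ whenever $B_i\le A_i$ for all $i$; (P3) $G_n(\omega;(1-s)\mathbf{A}+s\mathbf{B})\ge(1-s)G_n(\omega;\mathbf{A})+sG_n(\omega;\mathbf{B})$ for $0\le s\le1$; (P4) $\left[\sum_{i=1}^n w_iA_i^{-1}\right]^{-1}\le G_n(\omega;\mathbf{A})\le\sum_{i=1}^n w_iA_i$. Parameterized ordered mean: for real $\mu\ge0$ and $\mathbf{A}\in\mathbb{P}^n$, $G^\mu(\omega;\mathbf{A})=G_n^\mu(\omega;\mathbf{A}):=G_n(\omega;A_1+\mu I,\dots,A_n+\mu I)-\mu I$ (an element of $\mathbb{P}$). Power means: $A\#_pB=A^{1/2}(A^{-1/2}BA^{-1/2})^pA^{1/2}$.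 For $\lambda\in\Delta_k$ and $X_1,\dots,X_k\in\mathbb{P}$: for $p\in(0,1]$, $P_p(\lambda;X_1,\dots,X_k)$ is the unique solution $X\in\mathbb{P}$ of $X=\sum_{i=1}^k\lambda_i\,X\#_pX_i$; for $p\in[-1,0)$, $P_p(\lambda;X_1,\dots,X_k)=P_{-p}(\lambda;X_1^{-1},\dots,X_k^{-1})^{-1}$; and $P_0(\lambda;X_1,\dots,X_k)=\Lambda(\lambda;X_1,\dots,X_k)$ is the Karcher mean, the unique solution $X\in\mathbb{P}$ of $\sum_{i=1}^k\lambda_i\log(X^{1/2}X_i^{-1}X^{1/2})=0$. For positive scalars $P_p(\lambda;a_1,\dots,a_k)=(\sum_i\lambda_ia_i^p)^{1/p}$ if $p\ne0$ and $\prod_ia_i^{\lambda_i}$ if $p=0$. Convention at the endpoints: $P_p(1,0;X,Y)=X$ and $P_p(0,1;X,Y)=Y$. *)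

(* Defs.v *)
From HB Require Import structures.
From mathcomp Require Import all_boot all_order all_algebra.
From mathcomp Require Import complex.
From mathcomp Require Import all_classical all_reals all_analysis.

Set Implicit Arguments.
Unset Strict Implicit.
Unset Printing Implicit Defensive.

Import Order.TTheory GRing.Theory Num.Theory.
Import numFieldNormedType.Exports.

Local Open Scope classical_set_scope.
Local Open Scope complex_scope.
Local Open Scope ring_scope.

(* A Hilbert space is a complete normed space H over R[i], together with an
   inner product ip (linear in its first argument) that induces the norm.
   Operators are plain functions H -> H, with the pointwise vector space
   structure; everything of interest is restricted to bounded linear ones. *)
Definition induces_norm (R : realType) (H : completeNormedModType R[i])
    (ip : {dot H for Num.conj}) : Prop :=
  forall x : H, ip x x = `|x| ^+ 2.

Section Operators.
Variables (R : realType) (H : completeNormedModType R[i]).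
Variable ip : {dot H for Num.conj}.
Implicit Types (A B S T X Y : H -> H) (a p s t e : R).

Definition bounded_op T : Prop :=
  linear T /\ exists M : R, forall x : H, `|T x| <= M%:C * `|x|.

Definition self_adjoint T : Prop :=
  forall x y : H, ip (T x) y = ip x (T y).

Definition psd_op T : Prop :=
  [/\ bounded_op T, self_adjoint T & forall x : H, 0 <= ip (T x) x].

Definition loewner A B : Prop := psd_op (B - A).

Definition scalar_op a : H -> H := a%:C *: (idfun : H -> H).

Definition inverse_op T S : Prop :=
  [/\ bounded_op S, T \o S = idfun & S \o T = idfun].

Definition invertible_op T : Prop := exists S, inverse_op T S.

Definition inv_op T : H -> H := xget 0 [set S | inverse_op T S].

Definition pos_op T : Prop := psd_op T /\ invertible_op T.

(* Continuous functional calculus of a self-adjoint operator A, whose spectrum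
   is real: f(A) is the limit in operator norm of q(A) for real polynomials q
   tending to f uniformly on the spectrum. *)
Definition spectrum A : set R := [set s | ~ invertible_op (A - scalar_op s)].

Definition poly_op (q : {poly R}) A : H -> H :=
  \sum_(i < size q) (q`_i)%:C *: (iter i A : H -> H).

Definition is_fun_calc (f : R -> R) A T : Prop :=
  bounded_op T /\
  forall e, 0 < e -> exists q : {poly R},
    (forall s, spectrum A s -> `|q.[s] - f s| <= e) /\
    (forall x : H, `|poly_op q A x - T x| <= e%:C * `|x|).

Definition fun_calc (f : R -> R) A : H -> H :=
  xget 0 [set T | is_fun_calc f A T].

Definition pow_op A p : H -> H := fun_calc (fun s => s `^ p) A.

Definition log_op A : H -> H := fun_calc (fun s => ln s) A.

Definition geom_mean p A B : H -> H :=
  pow_op A 2^-1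
  \o pow_op (pow_op A (- 2^-1) \o B \o pow_op A (- 2^-1)) p
  \o pow_op A 2^-1.

Definition is_power_mean p k (l : 'I_k -> R) (Xs : 'I_k -> H -> H) X : Prop :=
  pos_op X /\ X = \sum_(i < k) (l i)%:C *: geom_mean p X (Xs i).

Definition is_karcher_mean k (l : 'I_k -> R) (Xs : 'I_k -> H -> H) X : Prop :=
  pos_op X /\
  \sum_(i < k)
    (l i)%:C *: log_op (pow_op X 2^-1 \o inv_op (Xs i) \o pow_op X 2^-1) = 0.

(* The defining equations have a unique solution when l is a positive
   probability vector, the Xs i are in the cone and -1 <= p <= 1; the value
   is junk otherwise. *)
Definition power_mean p k (l : 'I_k -> R) (Xs : 'I_k -> H -> H) : H -> H :=
  if 0 < p then xget 0 [set X | is_power_mean p l Xs X]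
  else if p < 0 then
    inv_op (xget 0 [set X | is_power_mean (- p) l (fun i => inv_op (Xs i)) X])
  else xget 0 [set X | is_karcher_mean l Xs X].

End Operators.

Definition scalar_power_mean (R : realType) (p : R) k (l a : 'I_k -> R) : R :=
  if p == 0 then \prod_(i < k) a i `^ l i
  else (\sum_(i < k) l i * a i `^ p) `^ p^-1.

Definition pair_fun (T : Type) (x y : T) : 'I_2 -> T :=
  fun i => if i == ord0 then x else y.

(* The two-variable means with weights (1 - t, t). The weights (1, 0) and
   (0, 1) are not strictly positive, and there the value is set by convention. *)
Definition power_mean2 (R : realType) (H : completeNormedModType R[i])
    (ip : {dot H for Num.conj}) (p t : R) (X Y : H -> H) : H -> H :=
  if t == 0 then X else if t == 1 then Y
  else power_mean ip p (pair_fun (1 - t) t) (pair_fun X Y).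

Definition scalar_power_mean2 (R : realType) (p t a b : R) : R :=
  if t == 0 then a else if t == 1 then b
  else scalar_power_mean p (pair_fun (1 - t) t) (pair_fun a b).

Definition pos_prob_vec (R : realType) n (w : 'I_n -> R) : Prop :=
  (forall i, 0 < w i) /\ \sum_(i < n) w i = 1.

(* There is no w with pos_prob_vec w for n = 0, so the clauses below only
   concern n >= 1. *)
Record ordered_mean (R : realType) (H : completeNormedModType R[i])
    (ip : {dot H for Num.conj})
    (G : forall n, ('I_n -> R) -> ('I_n -> H -> H) -> H -> H) : Prop := {
  om_pos : forall n (w : 'I_n -> R) (A : 'I_n -> H -> H),
    pos_prob_vec w -> (forall i, pos_op ip (A i)) -> pos_op ip (G n w A);
  om_homogeneous : forall n (w : 'I_n -> R) (A : 'I_n -> H -> H) (a : R),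
    pos_prob_vec w -> (forall i, pos_op ip (A i)) -> 0 < a ->
    G n w (fun i => a%:C *: A i) = a%:C *: G n w A;
  om_monotone : forall n (w : 'I_n -> R) (A B : 'I_n -> H -> H),
    pos_prob_vec w ->
    (forall i, pos_op ip (A i)) -> (forall i, pos_op ip (B i)) ->
    (forall i, loewner ip (B i) (A i)) -> loewner ip (G n w B) (G n w A);
  om_concave : forall n (w : 'I_n -> R) (A B : 'I_n -> H -> H) (s : R),
    pos_prob_vec w ->
    (forall i, pos_op ip (A i)) -> (forall i, pos_op ip (B i)) ->
    0 <= s <= 1 ->
    loewner ip ((1 - s)%:C *: G n w A + s%:C *: G n w B)
               (G n w (fun i => (1 - s)%:C *: A i + s%:C *: B i));
  om_agh : forall n (w : 'I_n -> R) (A : 'I_n -> H -> H),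
    pos_prob_vec w -> (forall i, pos_op ip (A i)) ->
    loewner ip (inv_op (\sum_(i < n) (w i)%:C *: inv_op (A i))) (G n w A) /\
    loewner ip (G n w A) (\sum_(i < n) (w i)%:C *: A i)
}.

Definition param_mean (R : realType) (H : completeNormedModType R[i])
    (G : forall n, ('I_n -> R) -> ('I_n -> H -> H) -> H -> H)
    (m : R) n (w : 'I_n -> R) (A : 'I_n -> H -> H) : H -> H :=
  G n w (fun i => A i + scalar_op m) - scalar_op m.

Definition increasing_path (R : realType) (H : completeNormedModType R[i])
    (ip : {dot H for Num.conj}) (F : R -> H -> H) : Prop :=
  forall s t : R, 0 <= s -> s <= t -> t <= 1 -> loewner ip (F s) (F t).

Definition decreasing_path (R : realType) (H : completeNormedModType R[i])
    (ip : {dot H for Num.conj}) (F : R -> H -> H) : Prop :=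
  forall s t : R, 0 <= s -> s <= t -> t <= 1 -> loewner ip (F t) (F s).

Definition interpolates_monotonically (R : realType)
    (H : completeNormedModType R[i]) (ip : {dot H for Num.conj})
    (m v : R) (X Y : H -> H) (F : R -> H -> H) : Prop :=
  [/\ F 0 = X, F 1 = Y,
      m <= v -> increasing_path ip F
    & v <= m -> decreasing_path ip F].

(* Main.v *)
From mathcomp Require Import all_boot all_order all_algebra.
From mathcomp Require Import complex.
From mathcomp Require Import all_classical all_reals all_analysis.
From mathcomp Require Import ring lra.
Require Import Defs.

Set Implicit Arguments.
Unset Strict Implicit.
Unset Printing Implicit Defensive.

Import Order.TTheory GRing.Theory Num.Theory.
Import numFieldNormedType.Exports.

Local Open Scope classical_set_scope.
Local Open Scope complex_scope.
Local Open Scope ring_scope.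

(** For two operators the power mean is explicit:
    P_p(1-t, t; A, B) = A #_f B := A^(1/2) f(A^(-1/2) B A^(-1/2)) A^(1/2)
    with f(s) = P_p(1-t, t; 1, s).  Indeed A #_f B = K f(K^-1 B L^-1) L for every
    factorization A = K L, so at F = A #_f B the defining equation
    (1-t) phi(F^(-1/2) A F^(-1/2)) + t phi(F^(-1/2) B F^(-1/2)) = kappa
    (phi(s) = s^p and kappa = 1 for p > 0, phi = ln and kappa = 0 for the Karcher
    mean) is a scalar identity in A^(-1/2) B A^(-1/2).  Conversely, if X solves the
    equation, then X^(-1/2) B X^(-1/2) is a function of X^(-1/2) A X^(-1/2), and the
    same congruence invariance gives X = A #_f B.  The case p < 0 follows by
    inversion.  If A <= B, the spectrum of A^(-1/2) B A^(-1/2) lies in [1, oo), where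
    f increases with t.

    As for G, concavity and homogeneity make it superadditive, hence
    G(A + (mu + d) I) >= G(A + mu I) + d I, that is, G^mu increases with mu. *)

(** * Weierstrass approximation *)

(** [fun_calc] selects an operator by approximation, so each use needs existence and uniqueness.
    Both rest on one estimate: if |q| <= e on the real spectrum of a symmetric A, then q(A) has norm
    at most e. It comes from positivity: the quadratic form of a symmetric operator is bounded below
    by any lower bound of its spectrum, and q(A) is invertible when the nonzero real polynomial q
    has no zero on the spectrum, the non-real roots giving coercive quadratic factors. The rules of
    the calculus are stated for the relation [is_fun_calc], which sees f on the spectrum only,
    because functions such as s^(1/p) are well behaved on part of the line only.

    General factorizations A = K L are forced by the equation itself: the square root of F = A #_f B
    is in general no function of C = A^(-1/2) B A^(-1/2), so neither is F^(-1/2) A F^(-1/2). With d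
    = f(C)^(1/2) and F = (A^(1/2) d) (d A^(1/2)), the operators relative to F become functions of
    C. *)

Section Weierstrass.
Variable R : realType.
Implicit Types (f : R -> R) (g h : nat -> R) (m M s x y c d e : R).

(* the Bernstein polynomial with nodes [g 0, .., g n], by Pascal's recursion:
   its value at x is the mean of g under the binomial law of size n *)
Fixpoint bernstein n g : {poly R} :=
  if n is n'.+1 then
    'X * bernstein n' (fun k => g k.+1) + (1 - 'X) * bernstein n' g
  else (g 0%N)%:P.

Lemma bernsteinS n g x : (bernstein n.+1 g).[x] =
  x * (bernstein n (fun k => g k.+1)).[x] + (1 - x) * (bernstein n g).[x].
Proof. by rewrite /= !hornerE. Qed.

Lemma bernsteinB n g h x : (bernstein n (fun k => g k - h k)).[x] =
  (bernstein n g).[x] - (bernstein n h).[x].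
Proof.
elim: n g h => [|n IH] g h; first by rewrite /= !hornerE.
by rewrite !bernsteinS !IH; ring.
Qed.

Lemma bernstein_const n c x : (bernstein n (fun=> c)).[x] = c.
Proof.
elim: n => [|n IH]; first by rewrite /= hornerC.
by rewrite !bernsteinS !IH; ring.
Qed.

(** The binomial law of size n has mean n x and variance n x (1 - x). The shift c is general because
    one branch of Pascal's recursion replaces it by 1 + c. *)
Lemma bernstein_square n a b c x :
  (bernstein n (fun k => a + b * (k%:R + c) ^+ 2)).[x] =
  a + b * ((n%:R * x + c) ^+ 2 + n%:R * x * (1 - x)).
Proof.
elim: n c => [|n IH] c; first by rewrite /= hornerC; ring.
rewrite bernsteinS IH.
have -> : (fun k : nat => a + b * (k.+1%:R + c) ^+ 2) =
          (fun k : nat => a + b * (k%:R + (1 + c)) ^+ 2).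
  by apply/funext => k; rewrite -natr1 -addrA.
by rewrite IH -natr1; ring.
Qed.

Lemma bernstein_le n g h x : 0 <= x <= 1 ->
  (forall k, (k <= n)%N -> g k <= h k) ->
  (bernstein n g).[x] <= (bernstein n h).[x].
Proof.
move=> /andP[x0 x1]; elim: n g h => [|n IH] g h gh.
  by rewrite /= !hornerC gh.
rewrite !bernsteinS lerD // ler_wpM2l ?subr_ge0 // IH // => k kn; apply: gh => //.
by rewrite leqW.
Qed.

(** Heine-Cantor by compactness. Continuity at the points of the segment is two-sided, also at its
    ends, so y may leave the segment. *)
Lemma continuous_segment_unif f m M :
  (forall s, m <= s <= M -> {for s, continuous f}) -> forall e, 0 < e ->
  exists2 d : R, 0 < d & forall x y, m <= x <= M -> `|x - y| < d -> `|f x - f y| < e.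
Proof.
move=> fc e e0.
have /compact_near_coveringP cov := @segment_compact R m M.
have H : \forall d \near (0 : R)^'+, `[m, M] `<=`
    (fun x => forall y, `|x - y| < d -> `|f x - f y| < e).
  apply: cov => x; rewrite /= in_itv /= => /fc /cvgrPdist_lt /(_ (e / 2)).
  case; rewrite ?divr_gt0 // => d /= d0 hd.
  exists (ball x (d / 2), [set t | t < d / 2]).
    split => /=; first by apply: nbhsx_ballx; rewrite divr_gt0.
    by apply: nbhs_right_lt; rewrite divr_gt0.
  move=> [x' t] /= [xx' td] y x'y.
  have h1 : `|f x - f x'| < e / 2.
    by apply: hd; rewrite /ball_ /=; move: xx'; rewrite -ball_normE /ball_ /=; lra.
  have h2 : `|f x - f y| < e / 2.
    apply: hd; rewrite /ball_ /= (le_lt_trans (ler_distD x' _ _)) //.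
    by move: xx' td x'y; rewrite -ball_normE /ball_ /=; lra.
  rewrite (le_lt_trans (ler_distD (f x) _ _)) // [`|f x' - _|]distrC; lra.
have [d [dH d0]] : exists d, `[m, M] `<=`
    (fun x => forall y, `|x - y| < d -> `|f x - f y| < e) /\ 0 < d.
  near (0 : R)^'+ => d; exists d; split; near: d => //.
  exact: nbhs_right_gt.
by exists d => // x y xm; apply: dH; rewrite /= in_itv.
Unshelve. all: by end_near. Qed.

Lemma continuous_segment_bounded f m M :
  (forall s, m <= s <= M -> {for s, continuous f}) ->
  exists2 K : R, 0 <= K & forall x, m <= x <= M -> `|f x| <= K.
Proof.
move=> fc.
have fw : {within `[m, M], continuous f}.
  by apply: continuous_in_subspaceT => x; rewrite inE /= in_itv /= => /fc.
have [mM|Mm] := leP m M; last first.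
  by exists 0 => // x /andP[h1 h2]; have := le_trans h1 h2; rewrite leNgt Mm.
have [c _ hc] := EVT_max mM fw; have [d _ hd] := EVT_min mM fw.
exists (`|f c| + `|f d|) => [|x]; first by rewrite addr_ge0.
move=> xm; rewrite ler_norml; apply/andP; split.
  rewrite (le_trans _ (hd x _)) ?in_itv //= lerNl.
  by rewrite (le_trans (ler_norm _)) // normrN lerDr.
by rewrite (le_trans (hc x _)) ?in_itv //= (le_trans (ler_norm _)) // lerDl.
Qed.

(** Bernstein's proof. The error |f (node k) - f s| is at most e / 2 plus a multiple of (k - n x)^2:
    uniform continuity gives this when node k is within d of s, and otherwise the crude bound 2 K
    may be multiplied by (node k - s)^2 / d^2 >= 1. The variance then controls the mean of the
    majorant. *)
Lemma weierstrass f m M :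
  (forall s, m <= s <= M -> {for s, continuous f}) -> forall e, 0 < e ->
  exists q : {poly R}, forall s, m <= s <= M -> `|q.[s] - f s| <= e.
Proof.
move=> fc e e0; have [mM|Mm] := ltP m M; last first.
  exists (f m)%:P => s /andP[h1 h2]; have -> : s = m by lra.
  by rewrite hornerC subrr normr0 ltW.
have e2 : 0 < e / 2 by rewrite divr_gt0.
have [d d0 hd] := continuous_segment_unif fc e2.
have [K K0 hK] := continuous_segment_bounded fc.
pose L := M - m; have L0 : 0 < L by rewrite subr_gt0.
(* As node k - s = L (k - n x) / n, the coefficient of (k - n x)^2 in the majorant is D / n^2; the
   variance n x (1 - x) turns it into at most D / n, which n makes smaller than e / 2. *)
pose D := 2 * K * L ^+ 2 / d ^+ 2.
have D0 : 0 <= D.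
  by rewrite divr_ge0 ?mulr_ge0 ?exprn_ge0 // ltW.
pose n := (Num.truncn (D / (e / 2))).+1.
have n0 : 0 < n%:R :> R by rewrite ltr0n.
have nD : D / n%:R <= e / 2.
  rewrite ler_pdivrMr // -ler_pdivrMl // mulrC ltW //.
  by rewrite /n truncnS_gt.
pose node (k : nat) := m + L * (k%:R / n%:R).
pose q := bernstein n (f \o node) \Po (L^-1 *: ('X - m%:P)).
exists q => s sm; set x := (s - m) / L.
have sx : s = m + L * x by rewrite /x; field; rewrite gt_eqF.
have x01 : 0 <= x <= 1.
  rewrite /x ler_pdivrMr // mul1r lerD2r divr_ge0 ?subr_ge0 //; last exact: ltW.
  by case/andP: sm.
  by case/andP: sm.
have -> : q.[s] = (bernstein n (f \o node)).[x].
  by rewrite /q horner_comp hornerZ hornerXsubC mulrC.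
rewrite -[f s](@bernstein_const n _ x) -bernsteinB.
pose b := D / (n%:R ^+ 2).
have bnd k : (k <= n)%N ->
    `|f (node k) - f s| <= e / 2 + b * (k%:R + (- n%:R * x)) ^+ 2.
  move=> kn.
  have nodes : m <= node k <= M.
    have k1 : k%:R / n%:R <= 1 :> R by rewrite ler_pdivrMr // mul1r ler_nat.
    have k0 : 0 <= k%:R / n%:R :> R by rewrite divr_ge0.
    have h1 : 0 <= L * (k%:R / n%:R) by rewrite mulr_ge0 // ltW.
    have h2 : L * (k%:R / n%:R) <= L by rewrite -[leRHS]mulr1 ler_wpM2l // ltW.
    by apply/andP; rewrite /node; move: h1 h2; rewrite /L; split; lra.
  have bb : 0 <= b * (k%:R + (- n%:R * x)) ^+ 2.
    by rewrite mulr_ge0 ?sqr_ge0 // divr_ge0 // exprn_ge0.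
  have [close|far] := ltP `|node k - s| d.
    by apply: ltW; apply: lt_le_trans (hd _ _ nodes close) _; rewrite lerDl.
  have h2K : `|f (node k) - f s| <= 2 * K.
    rewrite (le_trans (ler_normB _ _)) // mulr_natl mulr2n lerD //; exact: hK.
  rewrite (le_trans h2K) //.
  have -> : b * (k%:R + (- n%:R * x)) ^+ 2 = 2 * K * ((node k - s) ^+ 2 / d ^+ 2).
    by rewrite /b /D /node sx; field; rewrite !gt_eqF.
  rewrite (@le_trans _ _ (2 * K * ((node k - s) ^+ 2 / d ^+ 2))) //; last first.
    by rewrite lerDr ltW.
  rewrite -[leLHS]mulr1 ler_wpM2l ?mulr_ge0 // ler_pdivlMr ?exprn_gt0 // mul1r.
  by rewrite -[leRHS]real_normK ?num_real // ler_sqr ?nnegrE // ltW.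
have E : (bernstein n (fun k => e / 2 + b * (k%:R + (- n%:R * x)) ^+ 2)).[x] <= e.
  rewrite bernstein_square.
  have -> : n%:R * x + (- n%:R * x) = 0 by ring.
  have -> : e / 2 + b * (0 ^+ 2 + n%:R * x * (1 - x)) = e / 2 + D / n%:R * (x * (1 - x)).
    by rewrite /b; field; rewrite gt_eqF.
  have h1 : x * (1 - x) <= 1 by move/andP: x01 => []; nra.
  have h2 : 0 <= x * (1 - x) by move/andP: x01 => []; nra.
  have h3 : D / n%:R * (x * (1 - x)) <= e / 2.
    rewrite (le_trans _ nD) // -[leRHS]mulr1 ler_wpM2l // divr_ge0 //; exact: ltW.
  lra.
rewrite ler_norml; apply/andP; split; last first.
  apply: le_trans E; apply: bernstein_le => // k /bnd; exact: le_trans (ler_norm _).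
rewrite lerNl; apply: le_trans E.
rewrite -[leLHS]sub0r -[X in X - _](@bernstein_const n 0 x) -bernsteinB.
apply: bernstein_le => // k /bnd; apply: le_trans.
by rewrite sub0r -normrN ler_norm.
Qed.

End Weierstrass.

(** * The real inner product of a Hilbert space *)

Local Notation Re := complex.Re.

Section HilbertSpace.
Variables (R : realType) (H : completeNormedModType R[i]).
Variable ip : {dot H for Num.conj}.
Implicit Types (x y z : H) (a b : R) (S T : H -> H).

Lemma Re_ge0 (z : R[i]) : 0 <= z -> 0 <= Re z.
Proof. by rewrite lecE /= => /andP[]. Qed.

Lemma ReD (z z' : R[i]) : Re (z + z') = Re z + Re z'.
Proof. by case: z z' => [? ?] [? ?]. Qed.

Lemma ReN (z : R[i]) : Re (- z) = - Re z.
Proof. by case: z. Qed.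

Lemma ReM_real a (z : R[i]) : Re (a%:C * z) = a * Re z.
Proof. by case: z => [u v] /=; rewrite mul0r subr0. Qed.

(* the norm of H and its inner product take values in R[i]; [nr] and [rip] are
   their real parts *)
Definition nr x : R := Re `|x|.

Lemma normE x : `|x| = (nr x)%:C.
Proof.
have := normr_ge0 x; rewrite /nr lecE /= => /andP[/eqP h _].
by case: `|x| h => u v /= ->.
Qed.

Lemma nr_ge0 x : 0 <= nr x.
Proof. exact/Re_ge0/normr_ge0. Qed.

Lemma nr0 : nr 0 = 0.
Proof. by rewrite /nr normr0. Qed.

Lemma nr_eq0 x : nr x = 0 -> x = 0.
Proof. by move=> h; apply/normr0_eq0; rewrite normE h. Qed.

Lemma nrD x y : nr (x + y) <= nr x + nr y.
Proof. by rewrite -lecR rmorphD /= -!normE ler_normD. Qed.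

Lemma nrN x : nr (- x) = nr x.
Proof. by rewrite /nr normrN. Qed.

Lemma nrB x y : nr (x - y) = nr (y - x).
Proof. by rewrite -nrN opprB. Qed.

Lemma nrZ a x : nr (a%:C *: x) = `|a| * nr x.
Proof.
apply: complexI; rewrite -normE normrZ normE rmorphM /= normc_def /=.
by rewrite expr0n /= addr0 sqrtr_sqr.
Qed.

Lemma nr_triangle z x y : nr (x - y) <= nr (x - z) + nr (z - y).
Proof. by rewrite (le_trans _ (nrD _ _)) // addrA subrK. Qed.

Definition rip x y : R := Re (ip x y).

Lemma ripDl x y z : rip (x + y) z = rip x z + rip y z.
Proof. by rewrite /rip linearDl ReD. Qed.

Lemma ripDr x y z : rip z (x + y) = rip z x + rip z y.
Proof. by rewrite /rip linearDr ReD. Qed.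

Lemma ripNl x y : rip (- x) y = - rip x y.
Proof. by rewrite /rip linearNl ReN. Qed.

Lemma ripNr x y : rip x (- y) = - rip x y.
Proof. by rewrite /rip linearNr ReN. Qed.

Lemma ripBl x y z : rip (x - y) z = rip x z - rip y z.
Proof. by rewrite ripDl ripNl. Qed.

Lemma ripBr x y z : rip z (x - y) = rip z x - rip z y.
Proof. by rewrite ripDr ripNr. Qed.

Lemma ripZl a x y : rip (a%:C *: x) y = a * rip x y.
Proof. by rewrite /rip linearZl_LR ReM_real. Qed.

Lemma ripC x y : rip x y = rip y x.
Proof.
rewrite /rip hermC expr0 mul1r.
by apply: complexI; rewrite !complexRe Re_conj.
Qed.

Lemma ripZr a x y : rip x (a%:C *: y) = a * rip x y.
Proof. by rewrite ripC ripZl ripC. Qed.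

Definition symm T : Prop := forall x y, rip (T x) y = rip x (T y).

Hypothesis hip : induces_norm ip.

Lemma rip_nr x : rip x x = nr x ^+ 2.
Proof. by rewrite /rip hip normE -rmorphXn. Qed.


Lemma rip_ge0 x : 0 <= rip x x.
Proof. by rewrite rip_nr exprn_ge0 // nr_ge0. Qed.

Lemma rip0l x : rip 0 x = 0.
Proof. by rewrite /rip linear0l. Qed.

(* the discriminant argument, for the form of an arbitrary operator that is
   positive semi-definite *)
Lemma psd_cauchy_schwarz T x y : (forall u v, T (u + v) = T u + T v) ->
  (forall a u, T (a%:C *: u) = a%:C *: T u) -> symm T ->
  (forall u, 0 <= rip (T u) u) ->
  rip (T x) y ^+ 2 <= rip (T x) x * rip (T y) y.
Proof.
move=> TD TZ Ts T0.
set p := rip (T x) x; set q := rip (T x) y; set r := rip (T y) y.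
have key a : 0 <= p + 2 * a * q + a ^+ 2 * r.
  have := T0 (x + a%:C *: y).
  rewrite TD TZ !ripDl !ripDr !ripZl !ripZr (Ts y x) [rip y _]ripC.
  by rewrite -/p -/q -/r; congr (0 <= _); ring.
have p0 : 0 <= p by exact: T0.
have r0 : 0 <= r by exact: T0.
have [r1|r1] := eqVneq r 0.
  have [->|q0] := eqVneq q 0; first by rewrite expr0n /= mulr_ge0.
  have := key (- (p + 1) / (2 * q)).
  have -> : p + 2 * (- (p + 1) / (2 * q)) * q = - 1 by field.
  by rewrite r1 mulr0 addr0 oppr_ge0 ler10.
have := key (- q / r).
have -> : p + 2 * (- q / r) * q + (- q / r) ^+ 2 * r = (p * r - q ^+ 2) / r.
  by field.
by rewrite pmulr_lge0 ?subr_ge0 // invr_gt0 lt_def r1.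
Qed.

Lemma cauchy_schwarz x y : rip x y <= nr x * nr y.
Proof.
have := @psd_cauchy_schwarz id x y (fun _ _ => erefl) (fun _ _ => erefl)
  (fun _ _ => erefl) rip_ge0.
rewrite !rip_nr -exprMn => h.
have h0 : 0 <= nr x * nr y by rewrite mulr_ge0 ?nr_ge0.
rewrite (le_trans (ler_norm _)) // -(ger0_norm h0).
by rewrite -ler_sqr ?nnegrE // !real_normK ?num_real.
Qed.

(** Completeness with a real-valued rate that the limit inherits, so that later error estimates are
    read off directly. *)
Lemma complete_nr (u : nat -> H) (e : nat -> R) :
  (forall i j, (i <= j)%N -> nr (u j - u i) <= e i) ->
  (forall d, 0 < d -> exists i, e i < d) ->
  exists l, forall i, nr (l - u i) <= e i.
Proof.
move=> ue e0.
have Cof (eps : R[i]) : 0 < eps -> exists2 d : R, 0 < d & eps = d%:C.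
  by case: eps => a b; rewrite ltcE /= => /andP[/eqP -> a0]; exists a.
have /cauchy_cvgP uc : cauchy (u @ \oo).
  apply/cauchy_exP => eps /Cof[d d0 ->].
  have [i ei] := e0 d d0; exists (u i), i => //= j ij.
  rewrite -ball_normE /ball_ /= normE ltcR nrB.
  exact: le_lt_trans (ue _ _ ij) ei.
exists (lim (u @ \oo)) => i; apply/ler_addgt0Pr => /= d d0.
have dC : 0 < d%:C by rewrite ltcR.
have /cvgrPdist_lt /(_ _ dC) [N _ hN] := uc.
have := hN (maxn N i) (leq_maxl _ _).
rewrite /= normE ltcR => h.
rewrite (le_trans (nr_triangle (u (maxn N i)) _ _)) // addrC.
by apply: lerD; [exact: ue (leq_maxr _ _)|exact: ltW].
Qed.

Lemma bounded_opP T : bounded_op T <->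
  linear T /\ exists2 M, 0 <= M & forall x, nr (T x) <= M * nr x.
Proof.
split=> [[lT [M hM]]|[lT [M M0 hM]]]; split => //.
  exists `|M|; rewrite // => x; have := hM x.
  rewrite !normE -rmorphM /= lecR => /le_trans; apply.
  by rewrite ler_wpM2r ?nr_ge0 // ler_norm.
by exists M => x; rewrite !normE -rmorphM /= lecR.
Qed.

Lemma bounded_opD T x y : bounded_op T -> T (x + y) = T x + T y.
Proof. by case=> lT _; have := lT 1 x y; rewrite !scale1r. Qed.

Lemma bounded_op0 T : bounded_op T -> T 0 = 0.
Proof.
by move=> bT; apply: (addrI (T 0)); rewrite -bounded_opD // !addr0.
Qed.

Lemma bounded_opZ T (c : R[i]) x : bounded_op T -> T (c *: x) = c *: T x.
Proof.
by move=> bT; case: (bT) => lT _; have := lT c x 0; rewrite !addr0 bounded_op0 // addr0.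
Qed.

Lemma bounded_opN T x : bounded_op T -> T (- x) = - T x.
Proof. by move=> bT; rewrite -scaleN1r bounded_opZ // scaleN1r. Qed.

Lemma bounded_opB T x y : bounded_op T -> T (x - y) = T x - T y.
Proof. by move=> bT; rewrite bounded_opD // bounded_opN. Qed.

(** The imaginary part of z is - Re (i z), so the real identity at ['i *: x] supplies the imaginary
    part of the complex one. *)
Lemma self_adjointP T : bounded_op T -> self_adjoint ip T <-> symm T.
Proof.
move=> bT; split=> [h x y|h x y]; first by rewrite /rip h.
have ImE (z : R[i]) : complex.Im z = - Re ('i%C * z).
  by case: z => u v /=; rewrite !(mul0r, mul1r) sub0r opprK.
have := h x y; have := h ('i%C *: x) y.
rewrite bounded_opZ // /rip !linearZl_LR /= => hI hR.
by apply/eqP; rewrite eq_complex !ImE hI hR !eqxx.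
Qed.

(** The order on R[i] also asks for a vanishing imaginary part; self-adjointness gives it, since
    [ip (T x) x] is then its own conjugate. *)
Lemma psd_opP T : psd_op ip T <->
  [/\ bounded_op T, symm T & forall x, 0 <= rip (T x) x].
Proof.
split=> [[bT /(self_adjointP bT) sT T0]|[bT sT T0]]; split=> //.
- by move=> x; apply: Re_ge0.
- exact/self_adjointP.
move=> x; rewrite lecE /= T0 andbT.
have sT' := (self_adjointP bT).2 sT.
have /complex_realP[k ->] // : ip (T x) x \is Num.real.
by rewrite CrealE [X in _ == X]hermC expr0 mul1r sT'.
Qed.

End HilbertSpace.

(** * Bounded operators *)

Lemma geometric_small (R : realType) (C k : R) : 0 <= k -> k < 1 ->
  forall d, 0 < d -> exists i, C * k ^+ i < d.
Proof.
move=> k0 k1 d d0.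
have kn : `|k| < 1 by rewrite ger0_norm.
have := cvg_geometric C kn.
move=> /cvgrPdist_lt /(_ _ d0) [N _ /(_ N (leqnn N))] /=.
rewrite sub0r normrN => h; exists N.
exact: le_lt_trans (ler_norm _) h.
Qed.

Section Operators.
Variables (R : realType) (H : completeNormedModType R[i]).
Implicit Types (x y z : H) (a b c : R) (S T U N : H -> H).

Lemma linear_bounded_op T M : linear T -> 0 <= M ->
  (forall x, nr (T x) <= M * nr x) -> bounded_op T.
Proof. by move=> lT M0 hM; apply/bounded_opP; split => //; exists M. Qed.

Lemma bounded_op_id : bounded_op (idfun : H -> H).
Proof.
by apply: (@linear_bounded_op _ 1); rewrite ?ler01 // => x; rewrite mul1r.
Qed.

Lemma bounded_op_comp S T : bounded_op S -> bounded_op T -> bounded_op (S \o T).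
Proof.
move=> bS bT; have [_ [M M0 hM]] := (bounded_opP S).1 bS.
have [_ [L L0 hL]] := (bounded_opP T).1 bT.
apply: (@linear_bounded_op _ (M * L)); rewrite ?mulr_ge0 //.
  by move=> a x y /=; rewrite !(bounded_opD, bounded_opZ).
by move=> x /=; rewrite (le_trans (hM _)) // -mulrA ler_wpM2l.
Qed.

Lemma bounded_op_add S T : bounded_op S -> bounded_op T -> bounded_op (S + T).
Proof.
move=> bS bT; have [_ [M M0 hM]] := (bounded_opP S).1 bS.
have [_ [L L0 hL]] := (bounded_opP T).1 bT.
apply: (@linear_bounded_op _ (M + L)); rewrite ?addr_ge0 //.
  move=> a x y; rewrite !fctE !(bounded_opD _ _ bS, bounded_opD _ _ bT).
  by rewrite !(bounded_opZ _ _ bS, bounded_opZ _ _ bT) scalerDr addrACA.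
by move=> x; rewrite !fctE (le_trans (nrD _ _)) // mulrDl lerD.
Qed.

Lemma bounded_op_scale a T : bounded_op T -> bounded_op (a%:C *: T).
Proof.
move=> bT; have [_ [M M0 hM]] := (bounded_opP T).1 bT.
apply: (@linear_bounded_op _ (`|a| * M)); rewrite ?mulr_ge0 //.
  move=> b x y; rewrite !fctE bounded_opD // bounded_opZ // scalerDr !scalerA.
  by rewrite mulrC.
by move=> x; rewrite !fctE nrZ -mulrA ler_wpM2l.
Qed.

Lemma bounded_op_opp T : bounded_op T -> bounded_op (- T).
Proof.
move=> bT; have -> : - T = (-1)%:C *: T.
  by apply/funext => x; rewrite !fctE rmorphN scaleN1r.
exact: bounded_op_scale.
Qed.

Lemma bounded_op_sub S T : bounded_op S -> bounded_op T -> bounded_op (S - T).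
Proof. by move=> bS bT; apply/bounded_op_add/bounded_op_opp. Qed.

Lemma bounded_op_zero : bounded_op (0 : H -> H).
Proof.
have -> : 0 = 0%:C *: (idfun : H -> H).
  by apply/funext => x; rewrite !fctE scale0r.
exact/bounded_op_scale/bounded_op_id.
Qed.

Lemma bounded_op_scalar a : bounded_op (scalar_op a : H -> H).
Proof. exact/bounded_op_scale/bounded_op_id. Qed.

Lemma scalar_opE a x : scalar_op a x = a%:C *: x.
Proof. by []. Qed.

Lemma inverse_op_uniq T S U : inverse_op T S -> inverse_op T U -> S = U.
Proof.
case=> _ _ ST [_ TU _].
have : S \o (T \o U) = S by rewrite TU.
by rewrite compA ST.
Qed.

Lemma inv_opE T S : inverse_op T S -> inv_op T = S.
Proof.
move=> h; apply: inverse_op_uniq (h); rewrite /inv_op.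
by apply: (@xgetPex _ 0 [set S | inverse_op T S]); exists S.
Qed.

Lemma inverse_opP T S : inverse_op T S <->
  [/\ bounded_op S, cancel S T & cancel T S].
Proof.
split=> [[bS h1 h2]|[bS h1 h2]]; split=> //.
- by move=> x; have := congr1 (@^~ x) h1.
- by move=> x; have := congr1 (@^~ x) h2.
- exact/funext.
- exact/funext.
Qed.

Lemma inverse_op_sym T S : bounded_op T -> inverse_op T S -> inverse_op S T.
Proof. by move=> bT [bS h1 h2]; split. Qed.

Lemma inverse_op_comp T T' S S' : inverse_op T T' -> inverse_op S S' ->
  inverse_op (T \o S) (S' \o T').
Proof.
move=> /inverse_opP[bT h1 h2] /inverse_opP[bS h3 h4]; apply/inverse_opP.
split=> [|x|x] /=; first exact: bounded_op_comp.
  by rewrite h3.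
by rewrite h2.
Qed.

Lemma invertible_op_comp T S :
  invertible_op T -> invertible_op S -> invertible_op (T \o S).
Proof.
by move=> [T' hT] [S' hS]; exists (S' \o T'); apply: inverse_op_comp.
Qed.

(** Serves spectral mapping, where T = A - s is a factor of q(A) - q(s). The left inverse [U \o S]
    is two-sided because T commutes with S, hence with the product and with its inverse U. *)
Lemma invertible_op_factor S T : bounded_op S -> bounded_op T ->
  (forall x, S (T x) = T (S x)) -> invertible_op (S \o T) -> invertible_op T.
Proof.
move=> bS bT ST [U /inverse_opP[bU h1 h2]]; exists (U \o S).
rewrite /= in h1 h2; apply/inverse_opP; split=> [|x|x] /=.
- exact: bounded_op_comp.
- have TU y : T (U y) = U (T y).
    by rewrite -[LHS]h2 /= ST; congr (U (T _)); exact: h1.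
  by rewrite TU -ST h2.
- exact: h2.
Qed.

(** The lower bound serves twice: it makes T injective, and it bounds the inverse by c^-1. *)
Lemma invertible_op_bound T c : bounded_op T -> 0 < c ->
  (forall x, c * nr x <= nr (T x)) -> (forall y, exists x, T x = y) ->
  invertible_op T.
Proof.
move=> bT c0 hc /choice[S TS].
have inj x y : T x = T y -> x = y.
  move=> e; apply/subr0_eq/nr_eq0/eqP; rewrite eq_le nr_ge0 andbT.
  have := hc (x - y); rewrite bounded_opB // e subrr nr0.
  by rewrite pmulr_rle0.
exists S; apply/inverse_opP; split=> // [|x]; last exact/inj/TS.
apply: (@linear_bounded_op _ c^-1); first 1 last.
- by rewrite invr_ge0 ltW.
- by move=> x; rewrite -ler_pdivrMl ?invr_gt0 // invrK -{2}(TS x).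
by move=> a x y; apply: inj; rewrite TS bounded_opD // bounded_opZ // !TS.
Qed.

(** Only surjectivity takes work: the preimage of y is the fixed point of v |-> y + N v, the limit
    of the partial sums of the Neumann series. *)
Lemma neumann N k : bounded_op N -> 0 <= k -> k < 1 ->
  (forall x, nr (N x) <= k * nr x) -> invertible_op (idfun - N).
Proof.
move=> bN k0 k1 hk; have k1' : 0 < 1 - k by rewrite subr_gt0.
apply: (@invertible_op_bound _ (1 - k)) => //.
- exact/bounded_op_sub/bN/bounded_op_id.
- move=> x; rewrite !fctE mulrBl mul1r lerBlDr.
  rewrite -{1}[x](subrK (N x)) (le_trans (nrD _ _)) // lerD2l.
  exact: hk.
move=> y; pose u i := iter i (fun v => y + N v) y.
(* [C] solves C = nr y + k C, so the bound nr (u i) <= C passes from one iterate to the next. *)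
pose C := nr y / (1 - k).
have C0 : 0 <= C by rewrite mulr_ge0 ?nr_ge0 ?invr_ge0 ?ltW.
have yC : nr y = C - k * C by rewrite /C; field; rewrite gt_eqF.
have uC i : nr (u i) <= C.
  elim: i => [|i IH] /=; first by rewrite yC gerBl mulr_ge0.
  rewrite (le_trans (nrD _ _)) // yC -lerBrDl opprB addrC subrK.
  by rewrite (le_trans (hk _)) // ler_wpM2l.
have uS i : u i.+1 = y + N (u i) by [].
have ue m i : nr (u (i + m)%N - u i) <= C * k ^+ i.
  elim: i => [|i IH].
    rewrite mulr1 add0n; case: m => [|m]; first by rewrite subrr nr0.
    rewrite uS [u 0]/= addrC addKr (le_trans (hk _)) //.
    rewrite -[leRHS]mul1r ler_pM ?nr_ge0 //; exact: ltW.
  rewrite addSn !uS opprD addrACA subrr add0r -bounded_opB // (le_trans (hk _)) //.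
  by rewrite exprS mulrCA ler_wpM2l.
have [|l hl] := @complete_nr _ _ u (fun i => C * k ^+ i) _ (geometric_small C k0 k1).
  by move=> i j ij; rewrite -{1}(subnKC ij).
exists l; rewrite !fctE; apply/subr0_eq/nr_eq0/eqP.
rewrite eq_le nr_ge0 andbT; apply/ler_addgt0Pr => d d0; rewrite add0r.
have [i hi] := @geometric_small _ (2 * C) k k0 k1 d d0.
apply/ltW/(le_lt_trans _ hi).
have -> : l - N l - y = (l - u i.+1) - N (l - u i).
  rewrite uS bounded_opB // !opprD !opprK addrA.
  rewrite [- y - _]addrC -!addrA [- N l + N _]addrC; congr (_ + _).
  by rewrite [- y + _]addrC [- N l + - y]addrC -addrA addKr addrC.
have -> : 2 * C * k ^+ i = C * k ^+ i + C * k ^+ i by ring.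
rewrite (le_trans (nrD _ _)) // nrN lerD //.
  rewrite (le_trans (hl _)) // ler_wpM2l // exprS -[leRHS]mul1r.
  by rewrite ler_wpM2r ?exprn_ge0 // ltW.
rewrite (le_trans (hk _)) // -[leRHS]mul1r ler_pM ?nr_ge0 //.
exact: ltW.
Qed.

Lemma invertible_op_scale a T : bounded_op T ->
  invertible_op (a%:C *: T) -> invertible_op T.
Proof.
move=> bT [S /inverse_opP[bS h1 h2]]; exists (a%:C *: S).
apply/inverse_opP; split=> [|x|x]; first exact: bounded_op_scale.
  by rewrite fctE bounded_opZ //; exact: h1.
by rewrite fctE -bounded_opZ //; exact: h2.
Qed.

Lemma invertible_op_opp T : bounded_op T ->
  invertible_op (- T) -> invertible_op T.
Proof.
move=> bT; have -> : - T = (-1)%:C *: T; last exact: invertible_op_scale.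
by apply/funext => x; rewrite !fctE rmorphN scaleN1r.
Qed.

Variable ip : {dot H for Num.conj}.
Hypothesis hip : induces_norm ip.
Local Notation rip := (rip ip).
Local Notation symm := (symm ip).

Lemma symm_id : symm idfun.
Proof. by []. Qed.

Lemma symm_add S T : symm S -> symm T -> symm (S + T).
Proof. by move=> sS sT x y; rewrite !fctE ripDl ripDr sS sT. Qed.

Lemma symm_scale a T : symm T -> symm (a%:C *: T).
Proof. by move=> sT x y; rewrite !fctE ripZl ripZr sT. Qed.

Lemma symm_opp T : symm T -> symm (- T).
Proof. by move=> sT x y; rewrite !fctE ripNl ripNr sT. Qed.

Lemma symm_sub S T : symm S -> symm T -> symm (S - T).
Proof. by move=> sS sT; apply/symm_add/symm_opp. Qed.

Lemma symm_scalar a : symm (scalar_op a).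
Proof. exact/symm_scale/symm_id. Qed.

Lemma symm_conj S T : symm S -> symm T -> symm (S \o T \o S).
Proof. by move=> sS sT x y /=; rewrite sS sT sS. Qed.

Lemma symm_inverse T S : symm T -> inverse_op T S -> symm S.
Proof.
by move=> sT /inverse_opP[_ h1 _] x y; rewrite -{2}(h1 x) -{1}(h1 y) sT.
Qed.

(** For a suitable t > 0, expanding the squared norm shows that idfun - t T is a strict contraction;
    then t T is invertible by the Neumann series. *)
Lemma lax_milgram T c : bounded_op T -> 0 < c ->
  (forall x, c * nr x ^+ 2 <= rip (T x) x) -> invertible_op T.
Proof.
move=> bT c0 hc; have [_ [M0 M00 hM0]] := (bounded_opP T).1 bT.
(* Adding c makes M positive and at least c, so that 1 - (c / M)^2 is a square. *)
pose M := M0 + c.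
have M_gt0 : 0 < M by rewrite ltr_wpDl.
have hM x : nr (T x) <= M * nr x.
  by rewrite (le_trans (hM0 x)) // ler_wpM2r ?nr_ge0 // lerDl ltW.
have cM : c <= M by rewrite lerDr.
(* This t minimizes 1 - 2 t c + t^2 M^2, which bounds the squared norm of idfun - t T; the minimum
   is k^2 = 1 - (c / M)^2. *)
pose t := c / M ^+ 2.
have t0 : 0 < t by rewrite divr_gt0 // exprn_gt0.
have cM2 : (c / M) ^+ 2 <= 1.
  apply: exprn_ile1; first by rewrite divr_ge0 ?ltW.
  by rewrite ler_pdivrMr // mul1r.
pose k := Num.sqrt (1 - (c / M) ^+ 2).
have k2 : k ^+ 2 = 1 - (c / M) ^+ 2 by rewrite sqr_sqrtr // subr_ge0.
have k1 : k < 1.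
  by rewrite -[ltRHS]sqrtr1 ltr_sqrt // ltrBlDr ltrDl exprn_gt0 // divr_gt0.
apply: (@invertible_op_scale t) => //.
have -> : t%:C *: T = idfun - (idfun - t%:C *: T) by rewrite subKr.
apply: (@neumann _ k) => //; first 1 last.
- exact: sqrtr_ge0.
- move=> x; rewrite -ler_sqr ?nnegrE ?mulr_ge0 ?nr_ge0 ?sqrtr_ge0 //.
  rewrite exprMn k2 !fctE -(rip_nr hip).
  rewrite ripBl !ripBr !ripZl !ripZr [rip x (T x)]ripC !(rip_nr hip).
  have hTx : nr (T x) ^+ 2 <= M ^+ 2 * nr x ^+ 2.
    by rewrite -exprMn ler_sqr ?nnegrE ?mulr_ge0 ?nr_ge0 // ltW.
  have h1 : t ^+ 2 * nr (T x) ^+ 2 <= (c / M) ^+ 2 * nr x ^+ 2.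
    have -> : (c / M) ^+ 2 * nr x ^+ 2 = t ^+ 2 * (M ^+ 2 * nr x ^+ 2).
      by rewrite /t; field; rewrite gt_eqF.
    by rewrite ler_wpM2l // sqr_ge0.
  have h2 : (c / M) ^+ 2 * nr x ^+ 2 <= t * rip (T x) x.
    have -> : (c / M) ^+ 2 * nr x ^+ 2 = t * (c * nr x ^+ 2).
      by rewrite /t; field; rewrite gt_eqF.
    by rewrite ler_wpM2l // ltW.
  lra.
exact/bounded_op_sub/bounded_op_scale/bT/bounded_op_id.
Qed.

(** Cauchy-Schwarz for the form of T at S x and x, where S inverts T, reads |x|^4 <= (x, S x) (T x,
    x), and (x, S x) is at most a multiple of |x|^2. *)
Lemma psd_lower_bound T : bounded_op T -> symm T ->
  (forall x, 0 <= rip (T x) x) -> invertible_op T ->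
  exists2 c, 0 < c & forall x, c * nr x ^+ 2 <= rip (T x) x.
Proof.
move=> bT sT T0 [S /inverse_opP[bS h1 h2]].
have [_ [M M0 hM]] := (bounded_opP S).1 bS.
have M1 : 0 < M + 1 by rewrite ltr_wpDl.
exists (M + 1)^-1 => [|x]; first by rewrite invr_gt0.
rewrite ler_pdivrMl //.
have := @psd_cauchy_schwarz _ _ ip T (S x) x (fun u v => bounded_opD u v bT)
  (fun a u => bounded_opZ _ u bT) sT T0.
rewrite h1 !(rip_nr hip) => cs.
have hS : rip x (S x) <= (M + 1) * nr x ^+ 2.
  rewrite (le_trans (cauchy_schwarz hip _ _)) // expr2 mulrA mulrC.
  rewrite ler_wpM2r ?nr_ge0 // (le_trans (hM _)) // ler_wpM2r ?nr_ge0 //.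
  by rewrite lerDl.
have := nr_ge0 x; rewrite le_eqVlt => /orP[/eqP e|x0].
  by rewrite -e expr0n /= mulr_ge0 ?T0 // ltW.
have x20 : 0 < nr x ^+ 2 by rewrite exprn_gt0.
rewrite -(ler_pM2l x20) -expr2 (le_trans cs) // mulrCA mulrA.
by rewrite ler_wpM2r ?T0.
Qed.

(** Coercivity takes the place of invertibility in the cone; unlike invertibility it visibly
    survives sums and passage to larger operators. *)
Lemma pos_opP T : pos_op ip T <-> [/\ bounded_op T, symm T &
  exists2 c, 0 < c & forall x, c * nr x ^+ 2 <= rip (T x) x].
Proof.
split=> [[/psd_opP[bT sT T0] iT]|[bT sT [c c0 hc]]].
  by split=> //; apply: psd_lower_bound.
split; last exact: lax_milgram hc.
apply/psd_opP; split=> // x.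
by rewrite (le_trans _ (hc x)) // mulr_ge0 ?exprn_ge0 ?nr_ge0 // ltW.
Qed.

Lemma loewnerP S T : bounded_op S -> symm S -> bounded_op T -> symm T ->
  loewner ip S T <-> forall x, rip (S x) x <= rip (T x) x.
Proof.
move=> bS sS bT sT; split=> [/psd_opP[_ _ h] x|h].
  by have := h x; rewrite !fctE ripBl subr_ge0.
apply/psd_opP; split=> [||x]; first exact: bounded_op_sub.
  exact: symm_sub.
by rewrite !fctE ripBl subr_ge0.
Qed.

Lemma rip_bounded T : bounded_op T -> exists2 M, 0 <= M &
  forall x, - M * nr x ^+ 2 <= rip (T x) x <= M * nr x ^+ 2.
Proof.
move=> bT; have [_ [M M0 hM]] := (bounded_opP T).1 bT.
exists M => // x.
have h y : nr y = nr (T x) -> rip y x <= M * nr x ^+ 2.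
  move=> e; rewrite (le_trans (cauchy_schwarz hip _ _)) // e expr2 mulrA.
  by rewrite ler_wpM2r ?nr_ge0.
rewrite h // andbT mulNr lerNl -ripNl h //.
exact: nrN.
Qed.

Lemma spectrum_ge T c : bounded_op T ->
  (forall x, c * nr x ^+ 2 <= rip (T x) x) ->
  forall s, spectrum T s -> c <= s.
Proof.
move=> bT hc s sT; rewrite leNgt; apply/negP => sc; apply: sT.
apply: (@lax_milgram _ (c - s)); first exact/bounded_op_sub/bounded_op_scalar.
  by rewrite subr_gt0.
move=> x; rewrite !fctE scalar_opE ripBl ripZl (rip_nr hip) mulrBl.
by rewrite lerD2r.
Qed.

Lemma spectrum_le T c : bounded_op T ->
  (forall x, rip (T x) x <= c * nr x ^+ 2) ->
  forall s, spectrum T s -> s <= c.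
Proof.
move=> bT hc s sT; rewrite leNgt; apply/negP => sc; apply: sT.
have bTs : bounded_op (T - scalar_op s).
  exact/bounded_op_sub/bounded_op_scalar.
apply: invertible_op_opp => //.
apply: (@lax_milgram _ (s - c)); first exact: bounded_op_opp.
  by rewrite subr_gt0.
move=> x; rewrite !fctE scalar_opE ripNl ripBl ripZl (rip_nr hip) mulrBl.
by rewrite opprB lerD2l lerN2.
Qed.

(** The best lower bound of the form must be a spectral value: if it lay below c, T minus this bound
    would be positive semi-definite and invertible, hence coercive, and the bound could be
    raised. *)
Lemma rip_ge_spectrum T c : bounded_op T -> symm T ->
  (forall s, spectrum T s -> c <= s) ->
  forall x, c * nr x ^+ 2 <= rip (T x) x.
Proof.
move=> bT sT hc.
pose E := [set a | forall x, a * nr x ^+ 2 <= rip (T x) x].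
have Edown a b : a <= b -> E b -> E a.
  by move=> ab Eb x; rewrite (le_trans _ (Eb x)) // ler_wpM2r // exprn_ge0 // nr_ge0.
(* The negated goal also bounds [E] from above; on the zero space [E] is the whole line and has no
   supremum. *)
apply: contrapT => nEc.
have Ec a : E a -> a <= c.
  by move=> Ea; rewrite leNgt; apply/negP => /ltW /Edown/(_ Ea)/nEc.
have supE : has_sup E.
  split; last by exists c => a /Ec.
  have [M _ hM] := rip_bounded bT; exists (- M) => x.
  by case/andP: (hM x).
have Esup : E (sup E).
  move=> x; have := nr_ge0 x; rewrite le_eqVlt => /orP[/eqP e|x0].
    have x00 : x = 0 by apply: nr_eq0.
    by rewrite -e x00 bounded_op0 // rip0l expr0n /= mulr0.
  rewrite -ler_pdivlMr ?exprn_gt0 //; apply: ge_sup; first by case: supE.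
  by move=> a Ea; rewrite ler_pdivlMr ?exprn_gt0.
have supc : sup E < c.
  rewrite lt_neqAle (ge_sup supE.1) ?andbT //.
  by apply/eqP => e; rewrite e in Esup; apply: nEc.
have [d d0 hd] : exists2 d, 0 < d &
    forall x, d * nr x ^+ 2 <= rip ((T - scalar_op (sup E)) x) x.
  apply: psd_lower_bound.
  - exact/bounded_op_sub/bounded_op_scalar.
  - exact/symm_sub/symm_scalar.
  - move=> x; rewrite !fctE scalar_opE ripBl ripZl (rip_nr hip) subr_ge0.
    exact: Esup.
  by apply: contrapT => /hc; rewrite leNgt supc.
have : E (sup E + d).
  move=> x; have := hd x; rewrite !fctE scalar_opE ripBl ripZl (rip_nr hip).
  by rewrite mulrDl lerBrDl.
by move/(ub_le_sup supE.2); rewrite gerDl leNgt d0.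
Qed.

End Operators.

(** * Polynomials in a self-adjoint operator *)

Section PolynomialCalculus.
Variables (R : realType) (H : completeNormedModType R[i]).
Implicit Types (x y z : H) (a b c s : R) (A S T U N : H -> H) (q r : {poly R}).

Lemma poly_opE q A x n : (size q <= n)%N ->
  poly_op q A x = \sum_(i < n) (q`_i)%:C *: iter i A x.
Proof.
move=> qn; rewrite /poly_op fct_sumE /= (big_ord_widen _ (fun i => (q`_i)%:C *: iter i A x) qn).
rewrite [RHS](bigID (fun i : 'I_n => (i < size q)%N)) /= [X in _ + X]big1 ?addr0 //.
by move=> i; rewrite -leqNgt => /(nth_default 0) ->; rewrite scale0r.
Qed.

Lemma poly_opD q r A x : poly_op (q + r) A x = poly_op q A x + poly_op r A x.
Proof.
set n := maxn (size q) (size r).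
rewrite !(@poly_opE _ _ _ n) ?leq_maxl ?leq_maxr ?size_polyD // -big_split /=.
by apply: eq_bigr => i _; rewrite coefD rmorphD scalerDl.
Qed.

Lemma poly_opC c A x : poly_op c%:P A x = c%:C *: x.
Proof. by rewrite (@poly_opE _ _ _ 1) ?size_polyC_leq1 // big_ord1 coefC. Qed.

Lemma poly_opMX q A x : poly_op (q * 'X) A x = poly_op q A (A x).
Proof.
have sz : (size (q * 'X)%R <= (size q).+1)%N.
  by rewrite (leq_trans (size_polyMleq _ _)) // size_polyX addn2.
rewrite (poly_opE _ _ sz) (poly_opE _ _ (leqnn _)) big_ord_recl coefMX /=.
rewrite scale0r add0r; apply: eq_bigr => i _.
by rewrite /bump /= add1n coefMX /= -iterS iterSr.
Qed.

Lemma poly_opX A x : poly_op 'X A x = A x.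
Proof. by rewrite -['X]mul1r poly_opMX poly_opC scale1r. Qed.

Lemma poly_op_commute q A x : bounded_op A ->
  A (poly_op q A x) = poly_op q A (A x).
Proof.
move=> bA; elim/poly_ind: q x => [|q c IH] x.
  by rewrite !poly_opC !scale0r bounded_op0.
by rewrite !poly_opD !poly_opMX !poly_opC bounded_opD // bounded_opZ // IH.
Qed.

Lemma bounded_poly_op q A : bounded_op A -> bounded_op (poly_op q A).
Proof.
move=> bA; elim/poly_ind: q => [|q c IH].
  have -> : poly_op 0 A = 0; last exact: bounded_op_zero.
  by apply/funext => x; rewrite poly_opC scale0r.
have -> : poly_op (q * 'X + c%:P) A = poly_op q A \o A + scalar_op c.
  by apply/funext => x; rewrite poly_opD poly_opMX poly_opC.
exact/bounded_op_add/bounded_op_scalar/bounded_op_comp.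
Qed.

Lemma poly_opN q A x : poly_op (- q) A x = - poly_op q A x.
Proof.
by apply: (addrI (poly_op q A x)); rewrite -poly_opD !subrr poly_opC scale0r.
Qed.

Lemma poly_opB q r A x : poly_op (q - r) A x = poly_op q A x - poly_op r A x.
Proof. by rewrite poly_opD poly_opN. Qed.

Lemma poly_opM q r A x : bounded_op A ->
  poly_op (q * r) A x = poly_op q A (poly_op r A x).
Proof.
move=> bA; have bq := bounded_poly_op q bA.
elim/poly_ind: r x => [|r c IH] x.
  by rewrite mulr0 !poly_opC !scale0r bounded_op0.
rewrite mulrDr mulrA !poly_opD !poly_opMX poly_opC bounded_opD // IH.
congr (_ + _); rewrite bounded_opZ //.
elim/poly_ind: {IH bq} q x => [|q d IH] x.
  by rewrite mul0r !poly_opC !scale0r scaler0.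
rewrite mulrDl mulrAC !poly_opD !poly_opMX IH scalerDr -polyCM !poly_opC.
by rewrite scalerA rmorphM mulrC.
Qed.

Variable ip : {dot H for Num.conj}.
Hypothesis hip : induces_norm ip.
Local Notation rip := (rip ip).
Local Notation symm := (symm ip).

Lemma symm_poly_op q A : bounded_op A -> symm A -> symm (poly_op q A).
Proof.
move=> bA sA; elim/poly_ind: q => [|q c IH] x y.
  by rewrite !poly_opC !scale0r rip0l ripC rip0l.
rewrite !poly_opD !poly_opMX !poly_opC ripDl ripDr ripZl ripZr; congr (_ + _).
by rewrite IH sA poly_op_commute.
Qed.

(** Induction on the degree, splitting off a complex root a + b i. A real root lies outside the
    spectrum, so its linear factor is invertible at A. A non-real one gives the factor (X - a)^2 +
    b^2, whose value at the symmetric A is coercive with constant b^2. *)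
Lemma invertible_poly_op q A : bounded_op A -> symm A -> q != 0 ->
  (forall s, spectrum A s -> q.[s] != 0) -> invertible_op (poly_op q A).
Proof.
move=> bA sA; have [n] := ubnP (size q).
elim: n q => // n IH q /ltnSE qn q0 qs.
have [q1|q1] := leqP (size q) 1.
  have [c qc] : exists c, q = c%:P by exists q`_0; apply: size1_polyC.
  move: q0; rewrite qc polyC_eq0 => c0.
  exists (scalar_op c^-1); apply/inverse_opP.
  split=> [|x|x]; first exact: bounded_op_scalar.
    by rewrite poly_opC scalar_opE scalerA -rmorphM mulfV // scale1r.
  by rewrite poly_opC scalar_opE scalerA -rmorphM mulVf // scale1r.
pose qC := map_poly (real_complex R) q.
have /closed_rootP[z rz] : size qC != 1%N.
  by rewrite size_map_poly neq_ltn q1 orbT.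
case: z rz => a b rz.
have [b0|b0] := eqVneq b 0.
  have /factor_theorem[r qr] : root q a.
    by rewrite -(fmorph_root (real_complex R)) /= -complexr0 -b0.
  have r0 : r != 0 by apply: contra_neq q0 => r0; rewrite qr r0 mul0r.
  have -> : poly_op q A = poly_op r A \o (A - scalar_op a).
    apply/funext => x; rewrite qr poly_opM //= poly_opB poly_opX poly_opC.
    by [].
  apply: invertible_op_comp; last first.
    apply: contrapT => /qs; rewrite qr hornerM hornerXsubC subrr mulr0.
    by rewrite eqxx.
  apply: IH => //.
    by rewrite (leq_trans _ qn) // qr size_Mmonic ?monicXsubC // size_XsubC addn2.
  move=> s /qs; rewrite qr hornerM mulf_eq0 negb_or.
  by case/andP.
pose d : {poly R} := ('X - a%:P) ^+ 2 + (b ^+ 2)%:P.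
have szd : size d = 3%N.
  by rewrite /d size_polyDl size_exp_XsubC // ltnS (leq_trans (size_polyC_leq1 _)).
have d0 : d != 0 by rewrite -size_poly_eq0 szd.
have dz : root (map_poly (real_complex R) d) (Complex a b).
  rewrite rootE rmorphD rmorphXn rmorphB /= map_polyX !map_polyC /= !hornerE /=.
  apply/eqP/eqP; rewrite eq_complex /=; apply/andP.
  by split; apply/eqP; ring.
(* The remainder has real coefficients and degree at most 1, and it vanishes at the non-real number
   a + b i, so it is zero. *)
have dq : d %| q.
  rewrite /dvdp; set r := q %% d.
  have szr : (size r < 3)%N by rewrite -szd ltn_modp.
  have rC : root (map_poly (real_complex R) r) (Complex a b).
    have e : r = q - q %/ d * d by rewrite [X in X - _](divp_eq q d) [RHS]addrC addKr.
    rewrite rootE e rmorphB rmorphM /= !hornerE (rootP rz) (rootP dz).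
    by rewrite mulr0 subrr.
  have re : r = r`_1 *: 'X + (r`_0)%:P.
    apply/polyP => -[|[|i]]; rewrite !coefE /= ?mulr0 ?add0r ?mulr1 ?addr0 //.
    by rewrite nth_default // (leq_trans (ltnSE szr)).
  move: rC; rewrite rootE re rmorphD /= map_polyZ /= map_polyX map_polyC /=.
  rewrite !hornerE eq_complex /=; move/andP => [/eqP h1 /eqP h2].
  have r1 : r`_1 = 0.
    by apply/eqP; move/eqP: h2; rewrite !(mul0r, addr0) mulf_eq0 (negPf b0) orbF.
  move: h1; rewrite r1 !mul0r subr0 add0r => r00.
  by rewrite r00 scale0r addr0.
have qr : q = q %/ d * d by rewrite divpK.
set r := q %/ d in qr.
have r0 : r != 0 by apply: contra_neq q0 => r0; rewrite qr r0 mul0r.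
have -> : poly_op q A = poly_op r A \o poly_op d A.
  by apply/funext => x; rewrite {1}qr poly_opM.
apply: invertible_op_comp; last first.
  apply: (@lax_milgram _ _ ip _ _ (b ^+ 2)) => //.
  - exact: bounded_poly_op.
  - by rewrite exprn_even_gt0.
  move=> x; rewrite /d poly_opD poly_opC expr2 poly_opM // ripDl ripZl.
  rewrite rip_nr // lerDr (symm_poly_op _ bA sA) //.
  exact: rip_ge0.
apply: IH => //.
  rewrite (leq_trans _ qn) // qr size_mul // szd addn3 /=.
  by [].
by move=> s /qs; rewrite {1}qr hornerM mulf_eq0 negb_or => /andP[].
Qed.

(** For s < c the polynomial q - s has no zero on the spectrum of A, so s is outside the spectrum of
    q(A), and a lower bound of the spectrum bounds the form. *)
Lemma poly_op_ge q A c : bounded_op A -> symm A ->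
  (forall s, spectrum A s -> c <= q.[s]) ->
  forall x, c * nr x ^+ 2 <= rip (poly_op q A x) x.
Proof.
move=> bA sA qc; apply: rip_ge_spectrum => //.
- exact: bounded_poly_op.
- exact: symm_poly_op.
move=> s sps; rewrite leNgt; apply/negP => sc; apply: sps.
have e : poly_op q A - scalar_op s = poly_op (q - s%:P) A.
  by apply/funext => x; rewrite poly_opB poly_opC.
rewrite e; have [q0|q0] := eqVneq (q - s%:P) 0; last first.
  apply: invertible_poly_op => // t /qc ct.
  by rewrite !hornerE subr_eq0 gt_eqF // (lt_le_trans sc).
(* the spectrum is then empty, which forces H = 0 *)
have sp0 t : ~ spectrum A t.
  by move=> /qc; rewrite (subr0_eq q0) hornerC leNgt sc.
have H0 x : x = 0.
  have [M M0 hM] := rip_bounded hip bA.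
  apply: nr_eq0; apply/eqP; rewrite -sqrf_eq0 eq_le exprn_ge0 ?nr_ge0 // andbT.
  have := @rip_ge_spectrum _ _ ip hip A (M + 1) bA sA (fun t st => False_ind _ (sp0 t st)) x.
  by move=> h; have /andP[_ h'] := hM x; move: (le_trans h h'); rewrite mulrDl mul1r gerDl.
exists idfun; apply/inverse_opP; split; first exact: bounded_op_id.
  by move=> x; rewrite [LHS]H0 [RHS]H0.
by move=> x; rewrite [LHS]H0 [RHS]H0.
Qed.

(** The polynomial e^2 - q^2 is non-negative on the spectrum, and the form of its value at A is e^2
    |x|^2 - |q(A) x|^2. *)
Lemma poly_op_norm q A e : bounded_op A -> symm A -> 0 <= e ->
  (forall s, spectrum A s -> `|q.[s]| <= e) ->
  forall x, nr (poly_op q A x) <= e * nr x.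
Proof.
move=> bA sA e0 qe x.
have := @poly_op_ge ((e ^+ 2)%:P - q * q) A 0 bA sA.
rewrite -ler_sqr ?nnegrE ?mulr_ge0 ?nr_ge0 // exprMn => /(_ _ x).
rewrite poly_opB poly_opC poly_opM // ripBl ripZl rip_nr // symm_poly_op // rip_nr //.
rewrite mul0r subr_ge0; apply=> s /qe h.
by rewrite !hornerE subr_ge0 -expr2 -real_normK ?num_real // ler_sqr ?nnegrE.
Qed.

End PolynomialCalculus.

(** * Continuous functional calculus *)

Lemma le0_of_small (R : realType) (a K : R) : 0 <= K ->
  (forall d : R, 0 < d -> a <= d * K) -> a <= 0.
Proof.
move=> K0 h; apply/ler_addgt0Pr => /= e e0; rewrite add0r.
have K1 : 0 < K + 1 by rewrite ltr_wpDl.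
rewrite (le_trans (h (e / (K + 1)) _)) ?divr_gt0 //.
by rewrite -mulrA ler_piMr ?(ltW e0) // mulrC ler_pdivrMr // mul1r lerDl.
Qed.

Section FunctionalCalculus.
Variables (R : realType) (H : completeNormedModType R[i]).
Implicit Types (x y z : H) (a b c d e s m M : R) (A S T U W : H -> H)
  (q r : {poly R}) (f g : R -> R).

Lemma nr_eq0_of_small x K : 0 <= K ->
  (forall d : R, 0 < d -> nr x <= d * K) -> x = 0.
Proof.
by move=> K0 h; apply/nr_eq0/eqP; rewrite eq_le nr_ge0 (le0_of_small K0 h).
Qed.

Lemma nr_scale (z : R[i]) x : nr (z *: x) = complex.Re `|z| * nr x.
Proof.
by rewrite {1}/nr normrZ normE mulrC ReM_real mulrC.
Qed.

Lemma bounded_op_limit T :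
  (forall d, 0 < d -> exists2 S, bounded_op S &
     forall x, nr (S x - T x) <= d * nr x) -> bounded_op T.
Proof.
move=> lim.
have lT : linear T.
  move=> a x y; set n := complex.Re `|a|.
  have n0 : 0 <= n by apply/Re_ge0.
  apply/subr0_eq/(@nr_eq0_of_small _ (nr (a *: x + y) + n * nr x + nr y)).
    by rewrite !addr_ge0 ?mulr_ge0 ?nr_ge0.
  move=> d d0; have [S bS hS] := lim d d0.
  have -> : T (a *: x + y) - (a *: T x + T y) =
     - (S (a *: x + y) - T (a *: x + y)) + a *: (S x - T x) + (S y - T y).
    rewrite (bounded_opD _ _ bS) (bounded_opZ _ _ bS) scalerBr opprB.
    rewrite -!addrA; congr (_ + _).
    by rewrite (addrCA (- (a *: T x))) (addrA (a *: S x)) addKr opprD.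
  rewrite mulrDr mulrDr; apply: le_trans (nrD _ _) _; apply: lerD; last exact: hS.
  apply: le_trans (nrD _ _) _; apply: lerD; first by rewrite nrN; apply: hS.
  by rewrite nr_scale mulrCA ler_wpM2l.
have [S bS hS] := lim 1 ltr01; have [_ [M M0 hM]] := (bounded_opP S).1 bS.
apply: (@linear_bounded_op _ _ _ (M + 1)) => //; first by rewrite addr_ge0.
move=> x; have -> : T x = S x - (S x - T x) by rewrite subKr.
by rewrite (le_trans (nrD _ _)) // nrN mulrDl lerD.
Qed.

Lemma is_fun_calcP f A T : is_fun_calc f A T <-> bounded_op T /\
  forall e, 0 < e -> exists2 q, forall s, spectrum A s -> `|q.[s] - f s| <= e
    & forall x, nr (poly_op q A x - T x) <= e * nr x.
Proof.
split=> -[bT h]; split=> // e /h.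
  case=> q [h1 h2]; exists q => // x.
  by rewrite -lecR rmorphM /= -!normE.
case=> q h1 h2; exists q; split=> // x.
by rewrite !normE -rmorphM lecR.
Qed.

Lemma is_fun_calc_bounded f A T : is_fun_calc f A T -> bounded_op T.
Proof. by case. Qed.

(** Invertibility is an open condition: T' = T (1 - S (T - T')), where S (T - T') has norm at most M
    e < 1. *)
Lemma invertible_op_perturb T T' S M e : bounded_op T -> bounded_op T' ->
  inverse_op T S -> 0 <= M -> 0 <= e -> (forall x, nr (S x) <= M * nr x) ->
  (forall x, nr (T' x - T x) <= e * nr x) -> M * e < 1 -> invertible_op T'.
Proof.
move=> bT bT' iS M0 e0 hM he Me; have /inverse_opP[bS h1 h2] := iS.
have -> : T' = T \o (idfun - (S \o (T - T'))).
  apply/funext => x; rewrite /= !fctE /= bounded_opB // h1.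
  by rewrite subKr.
apply: invertible_op_comp; first by exists S.
apply: (@neumann _ _ _ (M * e)) => //.
- exact/bounded_op_comp/bounded_op_sub.
- by rewrite mulr_ge0.
- by move=> x /=; rewrite (le_trans (hM _)) // -mulrA ler_wpM2l // !fctE nrB.
Qed.

(** If T - f(s) were invertible, so would be the nearby q(A) - q(s), and with it the factor A -
    s. *)
Lemma spectrum_map f A T s : bounded_op A -> is_fun_calc f A T ->
  spectrum A s -> spectrum T (f s).
Proof.
move=> bA /is_fun_calcP[bT h] sA [S iS]; apply: sA.
have /inverse_opP[bS _ _] := iS; have [_ [M M0 hM]] := (bounded_opP S).1 bS.
apply: contrapT => sA.
have M1 : 0 < M + 1 by rewrite ltr_wpDl.
(* The error is incurred twice, between q(A) and T and between q(s) and f(s); the total (M + 1)^-1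
   stays below the perturbation threshold. *)
have e0 : 0 < (2 * (M + 1))^-1 by rewrite invr_gt0 mulr_gt0.
have [q q1 q2] := h _ e0.
have : invertible_op (poly_op q A - scalar_op q.[s]).
  apply: (@invertible_op_perturb _ _ _ M (M + 1)^-1 _ _ iS) => //.
  - exact/bounded_op_sub/bounded_op_scalar.
  - exact/bounded_op_sub/bounded_op_scalar/bounded_poly_op.
  - by rewrite invr_ge0 ltW.
  - move=> x; rewrite !fctE !scalar_opE.
    have -> : poly_op q A x - q.[s]%:C *: x - (T x - (f s)%:C *: x) =
       (poly_op q A x - T x) - (q.[s] - f s)%:C *: x.
      by rewrite rmorphB scalerBl !opprD !opprK addrACA.
    rewrite (le_trans (nrD _ _)) // nrN nrZ.
    have -> : (M + 1)^-1 * nr x = (2 * (M + 1))^-1 * nr x + (2 * (M + 1))^-1 * nr x.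
      by field; rewrite gt_eqF.
    by rewrite lerD // ler_wpM2r ?nr_ge0 // q1.
  - by rewrite ltr_pdivrMr // mul1r ltrDl.
have /factor_theorem[r qr] : root (q - q.[s]%:P) s.
  by rewrite rootE !hornerE subrr.
have e1 : poly_op q A - scalar_op q.[s] = poly_op r A \o (A - scalar_op s).
  apply/funext => x /=; rewrite !fctE !scalar_opE -(poly_opC _ A) -poly_opB qr.
  by rewrite poly_opM // poly_opB poly_opX poly_opC.
rewrite e1 => /invertible_op_factor i; apply: sA; apply: i.
- exact: bounded_poly_op.
- exact/bounded_op_sub/bounded_op_scalar.
move=> x; have br := bounded_poly_op r bA.
by rewrite !fctE !scalar_opE (bounded_opB _ _ br) (bounded_opZ _ _ br) poly_op_commute.
Qed.

Lemma is_fun_calc_poly q A : bounded_op A ->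
  is_fun_calc (fun s => q.[s]) A (poly_op q A).
Proof.
move=> bA; apply/is_fun_calcP; split; first exact: bounded_poly_op.
move=> e e0; exists q => [s _|x]; first by rewrite subrr normr0 ltW.
by rewrite subrr nr0 mulr_ge0 ?nr_ge0 // ltW.
Qed.

Lemma is_fun_calc_ext f g A T : (forall s, spectrum A s -> f s = g s) ->
  is_fun_calc f A T -> is_fun_calc g A T.
Proof.
move=> fg /is_fun_calcP[bT h]; apply/is_fun_calcP; split=> // e /h[q h1 h2].
by exists q => // s sA; rewrite -fg // h1.
Qed.

Lemma is_fun_calc_id A : bounded_op A -> is_fun_calc id A A.
Proof.
move=> bA; have := is_fun_calc_poly 'X bA.
have -> : poly_op 'X A = A by apply/funext => x; rewrite poly_opX.
by apply: is_fun_calc_ext => s _; rewrite hornerX.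
Qed.

Lemma is_fun_calc_const c A : bounded_op A ->
  is_fun_calc (fun=> c) A (scalar_op c).
Proof.
move=> bA; have := is_fun_calc_poly c%:P bA.
have -> : poly_op c%:P A = scalar_op c by apply/funext => x; rewrite poly_opC.
by apply: is_fun_calc_ext => s _; rewrite hornerC.
Qed.

Lemma is_fun_calcD f g A S T : is_fun_calc f A S -> is_fun_calc g A T ->
  is_fun_calc (fun s => f s + g s) A (S + T).
Proof.
move=> /is_fun_calcP[bS hS] /is_fun_calcP[bT hT]; apply/is_fun_calcP.
split=> [|e e0]; first exact: bounded_op_add.
have e2 : 0 < e / 2 by rewrite divr_gt0.
have [q q1 q2] := hS _ e2; have [r r1 r2] := hT _ e2.
exists (q + r) => [s sA|x].
  rewrite hornerD opprD addrACA (splitr e).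
  by rewrite (le_trans (ler_normD _ _)) // lerD ?q1 ?r1.
rewrite poly_opD !fctE opprD addrACA [e in e * _](splitr e) mulrDl.
by rewrite (le_trans (nrD _ _)) // lerD.
Qed.

Lemma is_fun_calcZ f c A T : is_fun_calc f A T ->
  is_fun_calc (fun s => c * f s) A (c%:C *: T).
Proof.
move=> /is_fun_calcP[bT hT]; apply/is_fun_calcP.
split=> [|e e0]; first exact: bounded_op_scale.
have c1 : 0 < `|c| + 1 by rewrite ltr_wpDl.
have [q q1 q2] := hT (e / (`|c| + 1)) (divr_gt0 e0 c1).
have ce : `|c| * (e / (`|c| + 1)) <= e.
  by rewrite mulrCA ler_piMr ?(ltW e0) // ler_pdivrMr // mul1r lerDl.
exists (c%:P * q) => [s sA|x].
  rewrite hornerM hornerC -mulrBr normrM (le_trans _ ce) //.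
  by rewrite ler_wpM2l // q1.
have -> : poly_op (c%:P * q) A x = c%:C *: poly_op q A x.
  have sz : (size (c%:P * q)%R <= size q)%N by rewrite mul_polyC size_scale_leq.
  rewrite (poly_opE _ _ sz) (poly_opE _ _ (leqnn _)) scaler_sumr.
  by apply: eq_bigr => i _; rewrite mul_polyC coefZ rmorphM scalerA.
rewrite !fctE -scalerBr nrZ.
by rewrite (le_trans (ler_wpM2l _ (q2 x))) // mulrA ler_wpM2r ?nr_ge0.
Qed.

(** Similarity keeps the spectrum and commutes with polynomials; W may fail to be unitary, which
    costs a factor N M in the operator error. *)
Lemma is_fun_calc_similar f A T W Wi : bounded_op W -> inverse_op W Wi ->
  is_fun_calc f A T -> is_fun_calc f (Wi \o A \o W) (Wi \o T \o W).
Proof.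
move=> bW iW /is_fun_calcP[bT hT]; have /inverse_opP[bWi h1 h2] := iW.
apply/is_fun_calcP; split; first exact/bounded_op_comp/bW/bounded_op_comp.
have [_ [M M0 hM]] := (bounded_opP W).1 bW.
have [_ [N N0 hN]] := (bounded_opP Wi).1 bWi.
move=> e e0; have NM1 : 0 < N * M + 1 by rewrite ltr_wpDl // mulr_ge0.
have NM2 : e / (N * M + 1) <= e.
  by rewrite ler_pdivrMr // ler_peMr ?(ltW e0) // lerDr mulr_ge0.
have NM3 : N * (e / (N * M + 1)) * M <= e.
  have -> : N * (e / (N * M + 1)) * M = e * ((N * M) / (N * M + 1)).
    by field; rewrite gt_eqF.
  by rewrite ler_piMr ?(ltW e0) // ler_pdivrMr // mul1r lerDl.
have [q q1 q2] := hT (e / (N * M + 1)) (divr_gt0 e0 NM1).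
exists q => [s sW|x].
  rewrite (le_trans _ NM2) // q1 // => iA; apply: sW.
  have -> : Wi \o A \o W - scalar_op s = Wi \o (A - scalar_op s) \o W.
    apply/funext => x; rewrite /= !fctE /= !scalar_opE (bounded_opB _ _ bWi).
    by rewrite (bounded_opZ _ _ bWi) h2.
  apply: invertible_op_comp; last by exists Wi.
  by apply: invertible_op_comp iA; exists W; apply: inverse_op_sym.
have -> : poly_op q (Wi \o A \o W) x = Wi (poly_op q A (W x)).
  elim/poly_ind: {q1 q2} q x => [|q c IH] x.
    by rewrite !poly_opC !scale0r bounded_op0.
  rewrite !poly_opD !poly_opMX !poly_opC IH /= h1.
  by rewrite (bounded_opD _ _ bWi) (bounded_opZ _ _ bWi) h2.
rewrite /= -bounded_opB // (le_trans (hN _)) //.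
rewrite (le_trans (ler_wpM2l N0 (q2 _))) //.
rewrite (le_trans _ (ler_wpM2r (nr_ge0 x) NM3)) // -!mulrA ler_wpM2l //.
rewrite !mulrA -[leRHS]mulrA ler_wpM2l // divr_ge0 //; exact: ltW.
Qed.

Variable ip : {dot H for Num.conj}.
Hypothesis hip : induces_norm ip.
Local Notation rip := (rip ip).
Local Notation symm := (symm ip).

Section SelfAdjoint.
Variable A : H -> H.
Hypotheses (bA : bounded_op A) (sA : symm A).

(** Two polynomials within d of f on the spectrum differ there by at most 2 d, hence so do their
    values at A; with the two approximation errors this puts S and T within 4 d. *)
Lemma is_fun_calc_uniq f S T : is_fun_calc f A S -> is_fun_calc f A T -> S = T.
Proof.
move=> /is_fun_calcP[bS hS] /is_fun_calcP[bT hT].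
apply/funext => x; apply/subr0_eq/(@nr_eq0_of_small _ (4 * nr x)).
  by rewrite mulr_ge0 ?nr_ge0.
move=> d d0; have [q q1 q2] := hS _ d0; have [r r1 r2] := hT _ d0.
have qr : nr (poly_op (q - r) A x) <= (d + d) * nr x.
  apply: (poly_op_norm hip) => // [|s sA']; first by rewrite addr_ge0 ?ltW.
  rewrite !hornerE; have -> : q.[s] - r.[s] = (q.[s] - f s) - (r.[s] - f s) by ring.
  by rewrite (le_trans (ler_normB _ _)) // lerD ?q1 ?r1.
have -> : S x - T x = - (poly_op q A x - S x) + poly_op (q - r) A x + (poly_op r A x - T x).
  by rewrite poly_opB opprB !addrA !subrK.
have -> : d * (4 * nr x) = d * nr x + (d + d) * nr x + d * nr x by ring.
rewrite (le_trans (nrD _ _)) // lerD // (le_trans (nrD _ _)) // lerD //.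
by rewrite nrN.
Qed.

Lemma fun_calcE f T : is_fun_calc f A T -> fun_calc f A = T.
Proof.
move=> fT; apply: (@is_fun_calc_uniq f) => //.
by apply: (@xgetPex _ 0 [set T | is_fun_calc f A T]); exists T.
Qed.

(** By [poly_op_norm], polynomials converging uniformly on the spectrum form a Cauchy sequence in
    operator norm; its limit is the required operator. *)
Lemma is_fun_calc_exists f :
  (forall e, 0 < e -> exists q, forall s, spectrum A s -> `|q.[s] - f s| <= e) ->
  is_fun_calc f A (fun_calc f A).
Proof.
move=> app; suff [T fT] : exists T, is_fun_calc f A T by rewrite (fun_calcE fT).
have h0 i : 0 < (1/2) ^+ i :> R by rewrite exprn_gt0.
have /choice[q hq] : forall i : nat, exists q, forall s, spectrum A s ->
    `|q.[s] - f s| <= (1/2) ^+ i by move=> i; apply: app.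
have cauchy x i j : (i <= j)%N ->
    nr (poly_op (q j) A x - poly_op (q i) A x) <= 2 * nr x * (1/2) ^+ i.
  move=> ij; rewrite -poly_opB mulrAC.
  have e0 : 0 <= 2 * (1 / 2) ^+ i :> R by rewrite mulr_ge0 // ltW.
  apply: (poly_op_norm hip bA sA e0) => s ss.
  have -> : (q j - q i).[s] = ((q j).[s] - f s) - ((q i).[s] - f s) by rewrite !hornerE; ring.
  rewrite (le_trans (ler_normB _ _)) // mulr_natl mulr2n lerD ?hq //.
  by rewrite (le_trans (hq _ _ ss)) // ler_wiXn2l //; lra.
have /choice[T hT] : forall x, exists l, forall i,
    nr (l - poly_op (q i) A x) <= 2 * nr x * (1/2) ^+ i.
  move=> x; apply: (complete_nr (cauchy x)).
  by apply: geometric_small; lra.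
have small e : 0 < e -> exists i, (1/2) ^+ i <= e /\ 2 * (1/2) ^+ i <= e.
  move=> e0; have [||i hi] := @geometric_small R 2 (1/2) _ _ e e0; try lra.
  exists i; split; last exact: ltW.
  by have := h0 i; lra.
exists T; apply/is_fun_calcP; split.
  apply: bounded_op_limit => d /small[i [_ di]].
  exists (poly_op (q i) A); first exact: bounded_poly_op.
  by move=> x; rewrite nrB (le_trans (hT _ i)) // mulrAC ler_wpM2r ?nr_ge0.
move=> e /small[i [e1 e2]]; exists (q i) => [s /hq h|x].
  exact: le_trans (h _) e1.
by rewrite nrB (le_trans (hT _ i)) // mulrAC ler_wpM2r ?nr_ge0.
Qed.

Lemma is_fun_calc_continuous f m M :
  (forall s, spectrum A s -> m <= s <= M) ->
  (forall s, m <= s <= M -> {for s, continuous f}) ->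
  is_fun_calc f A (fun_calc f A).
Proof.
move=> sp fc; apply: is_fun_calc_exists => e e0.
by have [q hq] := weierstrass fc e0; exists q => s /sp; apply: hq.
Qed.

Lemma is_fun_calc_ge f T c : is_fun_calc f A T ->
  (forall s, spectrum A s -> c <= f s) ->
  forall x, c * nr x ^+ 2 <= rip (T x) x.
Proof.
move=> /is_fun_calcP[bT hT] cf x; rewrite -subr_le0.
apply: (@le0_of_small _ _ (2 * nr x ^+ 2)).
  by rewrite mulr_ge0 ?exprn_ge0 ?nr_ge0.
move=> d d0; have [q q1 q2] := hT d d0.
have h1 : (c - d) * nr x ^+ 2 <= rip (poly_op q A x) x.
  apply: (poly_op_ge hip) => // s ss; have := cf s ss; have := q1 s ss.
  by rewrite ler_norml => /andP[]; lra.
have h2 : rip (poly_op q A x - T x) x <= d * nr x ^+ 2.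
  rewrite (le_trans (cauchy_schwarz hip _ _)) // expr2 mulrA.
  by rewrite ler_wpM2r ?nr_ge0.
by move: h1 h2; rewrite ripBl mulrBl; lra.
Qed.

Lemma is_fun_calc_le f T c : is_fun_calc f A T ->
  (forall s, spectrum A s -> f s <= c) ->
  forall x, rip (T x) x <= c * nr x ^+ 2.
Proof.
move=> /(is_fun_calcZ (-1)) /(is_fun_calc_ge (c := - c)) h fc x.
have := h _ x; rewrite !fctE ripZl mulNr mulN1r lerN2; apply => s ss.
by rewrite mulN1r lerN2 fc.
Qed.

Lemma is_fun_calc_symm f T : is_fun_calc f A T -> symm T.
Proof.
move=> /is_fun_calcP[bT hT] x y; apply/eqP; rewrite -subr_eq0 -normr_eq0.
rewrite eq_le normr_ge0 andbT.
apply: (@le0_of_small _ _ (2 * (nr x * nr y))).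
  by rewrite mulr_ge0 // mulr_ge0 ?nr_ge0.
move=> d d0; have [q _ q2] := hT d d0.
have sq := symm_poly_op q bA sA.
have h u v : rip (poly_op q A u - T u) v <= d * (nr u * nr v).
  by rewrite (le_trans (cauchy_schwarz hip _ _)) // mulrA ler_wpM2r ?nr_ge0.
have e : rip y (poly_op q A x) = rip x (poly_op q A y) by rewrite ripC sq.
have := h x y; have := h y x; have := h (- x) y; have := h (- y) x.
rewrite !nrN !(bounded_opN _ bT) !(bounded_opN _ (bounded_poly_op q bA)).
rewrite !ripBl !ripNl sq ![rip _ x]ripC sq [nr y * nr x]mulrC ler_norml => h1 h2 h3 h4.
by apply/andP; split; lra.
Qed.

(** Prepares the product rule. No continuity of f is at hand, but spectral mapping places f(s) in
    the spectrum of T, which the bounds of its form enclose. *)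
Lemma is_fun_calc_bounded_on f T : is_fun_calc f A T ->
  exists2 K, 0 <= K & forall s, spectrum A s -> `|f s| <= K.
Proof.
move=> fT; have bT := is_fun_calc_bounded fT.
have [K K0 hK] := rip_bounded hip bT.
exists K => // s /(spectrum_map bA fT) sT; rewrite ler_norml.
rewrite (spectrum_ge hip bT _ sT) ?(spectrum_le hip bT _ sT) // => x.
  by case/andP: (hK x).
by case/andP: (hK x).
Qed.

Lemma is_fun_calcM f g S T : is_fun_calc f A S -> is_fun_calc g A T ->
  is_fun_calc (fun s => f s * g s) A (S \o T).
Proof.
move=> fS gT; have [F F0 hF] := is_fun_calc_bounded_on fS.
have [G G0 hG] := is_fun_calc_bounded_on gT.
move: fS gT => /is_fun_calcP[bS hS] /is_fun_calcP[bT hT]; apply/is_fun_calcP.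
have [_ [M M0 hM]] := (bounded_opP S).1 bS.
have [_ [N N0 hN]] := (bounded_opP T).1 bT.
split=> [|e e0]; first exact: bounded_op_comp.
(* [d * K] dominates both the scalar error d (1 + G + F) and the operator error d (N + 1 + M); d <=
   1 absorbs the terms quadratic in d. *)
pose K := F + G + M + N + 1.
have K0 : 0 < K by rewrite /K; lra.
pose d := Num.min 1 (e / K).
have d0 : 0 < d by rewrite lt_min ltr01 divr_gt0.
have d1 : d <= 1 by rewrite ge_min lexx.
have dK : d * K <= e by rewrite -ler_pdivlMr // ge_min lexx orbT.
have [q q1 q2] := hS d d0; have [r r1 r2] := hT d d0.
exists (q * r) => [s ss|x].
  have := q1 s ss; have := r1 s ss; have := hF s ss; have := hG s ss.
  move=> g1 f1 rd qd; rewrite hornerM.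
  have -> : q.[s] * r.[s] - f s * g s = (q.[s] - f s) * (r.[s] - g s)
      + (q.[s] - f s) * g s + f s * (r.[s] - g s) by ring.
  apply: (le_trans (ler_normD _ _)); apply: (@le_trans _ _ (d * 1 + d * G + F * d)).
    apply: lerD; last by rewrite normrM ler_pM.
    apply: (le_trans (ler_normD _ _)); rewrite !normrM lerD ?ler_pM //.
    exact: le_trans rd _.
  rewrite (le_trans _ dK) // /K; have := mulr_ge0 (ltW d0) M0.
  by have := mulr_ge0 (ltW d0) N0; lra.
rewrite poly_opM //=; set u := poly_op r A x.
have -> : poly_op q A u - S (T x) = (poly_op q A u - S u) + S (u - T x).
  by rewrite bounded_opB // addrA subrK.
have hu : nr u <= (N + 1) * nr x.
  have -> : u = T x + (u - T x) by rewrite addrC subrK.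
  rewrite (le_trans (nrD _ _)) // mulrDl lerD // (le_trans (r2 x)) //.
  by rewrite ler_wpM2r ?nr_ge0.
rewrite (le_trans (nrD _ _)) //.
apply: (@le_trans _ _ (d * ((N + 1) * nr x) + M * (d * nr x))).
  apply: lerD; first by rewrite (le_trans (q2 _)) // ler_wpM2l // ltW.
  by rewrite (le_trans (hM _)) // ler_wpM2l // r2.
apply: le_trans (ler_wpM2r (nr_ge0 x) dK).
have -> : d * ((N + 1) * nr x) + M * (d * nr x) = d * (N + 1 + M) * nr x by ring.
rewrite ler_wpM2r ?nr_ge0 // ler_wpM2l ?(ltW d0) // /K; lra.
Qed.

(** A polynomial in T is a function of A by the sum and product rules, and spectral mapping carries
    an approximation of g on the spectrum of T to one of g o f on that of A. *)
Lemma is_fun_calc_comp f g T S : is_fun_calc f A T -> is_fun_calc g T S ->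
  is_fun_calc (g \o f) A S.
Proof.
move=> fT gS; have bT := is_fun_calc_bounded fT.
have qf q : is_fun_calc (fun s => q.[f s]) A (poly_op q T).
  elim/poly_ind: q => [|q c IH].
    have -> : poly_op 0 T = scalar_op 0.
      by apply/funext => x; rewrite poly_opC.
    apply: is_fun_calc_ext (is_fun_calc_const 0 bA) => s _.
    by rewrite horner0.
  have -> : poly_op (q * 'X + c%:P) T = poly_op q T \o T + scalar_op c.
    by apply/funext => x; rewrite poly_opD poly_opMX poly_opC.
  apply: is_fun_calc_ext (is_fun_calcD (is_fun_calcM IH fT) (is_fun_calc_const c bA)) => s _.
  by rewrite !hornerE.
have bS := is_fun_calc_bounded gS.
apply/is_fun_calcP; split=> // e e0.
have e2 : 0 < e / 2 by rewrite divr_gt0.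
have [_ /(_ _ e2)[q q1 q2]] := (is_fun_calcP _ _ _).1 gS.
have [_ /(_ _ e2)[r r1 r2]] := (is_fun_calcP _ _ _).1 (qf q).
exists r => [s ss|x].
  have -> : r.[s] - (g \o f) s = (r.[s] - q.[f s]) + (q.[f s] - g (f s)) by rewrite /=; ring.
  rewrite (splitr e) (le_trans (ler_normD _ _)) // lerD ?r1 // q1 //.
  exact: spectrum_map fT ss.
rewrite (le_trans (nr_triangle (poly_op q T x) _ _)) //.
by rewrite [e in e * _](splitr e) mulrDl lerD.
Qed.

End SelfAdjoint.
End FunctionalCalculus.

(** * The means A #_f B *)

(** Powers and [ln] are total functions on R; continuity at positive points is enough because the
    spectrum of an element of the cone lies in a compact part of the open half-line. *)
Definition continuous_pos (R : realType) (f : R -> R) : Prop :=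
  forall s : R, 0 < s -> {for s, continuous f}.

Section ContinuousPos.
Variable R : realType.
Implicit Types (f g : R -> R) (a p s : R).

Lemma continuous_pos_powR p : continuous_pos (fun s => s `^ p).
Proof.
move=> s s0; apply/differentiable_continuous/derivable1_diffP.
by apply: derivable_powR; rewrite in_itv /= s0.
Qed.

Lemma continuous_pos_ln : continuous_pos (@ln R).
Proof. by move=> s; apply: continuous_ln. Qed.

Lemma continuous_pos_comp f g : (forall s, 0 < s -> 0 < f s) ->
  continuous_pos f -> continuous_pos g -> continuous_pos (fun s => g (f s)).
Proof.
move=> f0 cf cg s s0; apply: (@continuous_comp _ _ _ f g); first exact: cf.
exact/cg/f0.
Qed.

Lemma continuous_pos_inv f : (forall s, 0 < s -> 0 < f s) ->
  continuous_pos f -> continuous_pos (fun s => (f s)^-1).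
Proof.
move=> f0 cf s s0; apply: cvgV; last exact: cf.
by rewrite gt_eqF // f0.
Qed.

Lemma continuous_posM f g :
  continuous_pos f -> continuous_pos g -> continuous_pos (fun s => f s * g s).
Proof. by move=> cf cg s s0; apply: cvgM; [apply: cf|apply: cg]. Qed.

Lemma continuous_posD f g :
  continuous_pos f -> continuous_pos g -> continuous_pos (fun s => f s + g s).
Proof. by move=> cf cg s s0; apply: cvgD; [apply: cf|apply: cg]. Qed.

Lemma continuous_pos_cst a : continuous_pos (fun=> a).
Proof. by move=> s _; apply: cvg_cst. Qed.

Lemma continuous_pos_id : continuous_pos (fun s : R => s).
Proof. by move=> s _; apply: cvg_id. Qed.

End ContinuousPos.

Section GeneralizedMeans.
Variables (R : realType) (H : completeNormedModType R[i]).
Implicit Types (x y z : H) (a b c d e s t m M kappa : R)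
  (A B C K L S T U W X : H -> H) (f g phi psi : R -> R).
Variable ip : {dot H for Num.conj}.
Hypothesis hip : induces_norm ip.
Local Notation rip := (rip ip).
Local Notation symm := (symm ip).
Local Notation pos_op := (pos_op ip).

Lemma pos_op_bounded A : pos_op A -> bounded_op A.
Proof. by move=> /(pos_opP hip)[]. Qed.

Lemma pos_op_symm A : pos_op A -> symm A.
Proof. by move=> /(pos_opP hip)[]. Qed.

Lemma pos_op_inverse A : pos_op A -> inverse_op A (inv_op A).
Proof. by case=> _ [S iS]; rewrite (inv_opE iS). Qed.

Lemma pos_op_intro A : bounded_op A -> symm A -> (forall x, 0 <= rip (A x) x) ->
  invertible_op A -> pos_op A.
Proof. by move=> bA sA A0 iA; split=> //; apply/psd_opP. Qed.

Lemma pos_op_inv A : pos_op A -> pos_op (inv_op A).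
Proof.
move=> pA; have iA := pos_op_inverse pA; have /inverse_opP[bi h1 h2] := iA.
have sA := pos_op_symm pA; have bA := pos_op_bounded pA.
apply: pos_op_intro => //.
- exact: symm_inverse iA.
- move=> x; case: pA => /psd_opP[_ _ /(_ (inv_op A x))].
  by rewrite h1 ripC.
- by exists A; apply: inverse_op_sym.
Qed.

Lemma pos_op_spectrum A : pos_op A -> exists m M,
  0 < m /\ forall s, spectrum A s -> m <= s <= M.
Proof.
move=> /(pos_opP hip)[bA sA [c c0 hc]]; have [M _ hM] := rip_bounded hip bA.
exists c, M; split=> // s ss; rewrite (spectrum_ge hip bA hc ss) /=.
by apply: (spectrum_le hip bA _ ss) => x; case/andP: (hM x).
Qed.

Lemma pos_op_spectrum_gt0 A s : pos_op A -> spectrum A s -> 0 < s.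
Proof.
move=> /pos_op_spectrum[m [M [m0 h]]] /h /andP[ms _].
exact: lt_le_trans ms.
Qed.

Lemma is_fun_calc_pos f A : pos_op A -> continuous_pos f ->
  is_fun_calc f A (fun_calc f A).
Proof.
move=> pA cf; have [m [M [m0 sp]]] := pos_op_spectrum pA.
apply: (is_fun_calc_continuous hip (pos_op_bounded pA) (pos_op_symm pA) sp).
by move=> s /andP[ms _]; apply: cf; apply: lt_le_trans ms.
Qed.

Lemma is_fun_calc_eq f g A S T : bounded_op A -> symm A ->
  is_fun_calc f A S -> is_fun_calc g A T ->
  (forall s, spectrum A s -> f s = g s) -> S = T.
Proof.
move=> bA sA fS gT fg; apply: (is_fun_calc_uniq hip bA sA _ gT).
exact: is_fun_calc_ext fS.
Qed.

Lemma scalar_op1 : scalar_op 1 = idfun :> (H -> H).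
Proof. by apply/funext => x; rewrite scalar_opE scale1r. Qed.

Lemma is_fun_calc_inverse f g A S T : bounded_op A -> symm A ->
  is_fun_calc f A S -> is_fun_calc g A T ->
  (forall s, spectrum A s -> f s * g s = 1) -> inverse_op S T.
Proof.
move=> bA sA fS gT fg.
have one := is_fun_calc_const 1 bA; rewrite scalar_op1 in one.
split; first exact: is_fun_calc_bounded gT.
  exact: is_fun_calc_eq (is_fun_calcM hip bA fS gT) one fg.
apply: is_fun_calc_eq (is_fun_calcM hip bA gT fS) one _ => // s /fg.
by rewrite mulrC.
Qed.

Lemma pos_op_fun_calc f A : pos_op A -> continuous_pos f ->
  (forall s, 0 < s -> 0 < f s) -> pos_op (fun_calc f A).
Proof.
move=> pA cf f0; have fA := is_fun_calc_pos pA cf.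
have bA := pos_op_bounded pA; have sA := pos_op_symm pA.
apply: pos_op_intro.
- exact: is_fun_calc_bounded fA.
- exact: is_fun_calc_symm fA.
- move=> x; rewrite -[leLHS](mul0r (nr x ^+ 2)).
  apply: (is_fun_calc_ge hip bA sA fA).
  by move=> s /(pos_op_spectrum_gt0 pA) s0; apply/ltW/f0.
- exists (fun_calc (fun s => (f s)^-1) A).
  apply: is_fun_calc_inverse bA sA fA (is_fun_calc_pos pA _) _.
    exact: continuous_pos_inv.
  by move=> s /(pos_op_spectrum_gt0 pA) s0; rewrite mulfV // gt_eqF // f0.
Qed.

Lemma pos_op_conj S A : bounded_op S -> symm S -> invertible_op S ->
  pos_op A -> pos_op (S \o A \o S).
Proof.
move=> bS sS iS pA; have bA := pos_op_bounded pA; apply: pos_op_intro.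
- exact/bounded_op_comp/bS/bounded_op_comp.
- exact/symm_conj/pos_op_symm.
- by move=> x /=; rewrite sS; case: pA => /psd_opP[_ _].
- by apply/invertible_op_comp/iS/invertible_op_comp; case: pA.
Qed.

Lemma pos_op_sqrt A : pos_op A ->
  [/\ pos_op (pow_op A 2^-1), pos_op (pow_op A (- 2^-1)),
      inverse_op (pow_op A 2^-1) (pow_op A (- 2^-1)) &
      pow_op A 2^-1 \o pow_op A 2^-1 = A].
Proof.
move=> pA; have bA := pos_op_bounded pA; have sA := pos_op_symm pA.
have cp p := @continuous_pos_powR R p.
have p0 p s : 0 < s -> 0 < s `^ p by apply: powR_gt0.
split.
- exact: (pos_op_fun_calc pA (cp _) (p0 _)).
- exact: (pos_op_fun_calc pA (cp _) (p0 _)).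
- apply: (is_fun_calc_inverse bA sA (is_fun_calc_pos pA (cp _)) (is_fun_calc_pos pA (cp _))).
  move=> s /(pos_op_spectrum_gt0 pA) s0.
  by rewrite powRN mulfV // gt_eqF // p0.
apply: (is_fun_calc_eq bA sA _ (is_fun_calc_id bA)).
  exact: (is_fun_calcM hip bA (is_fun_calc_pos pA (cp _)) (is_fun_calc_pos pA (cp _))).
move=> s /(pos_op_spectrum_gt0 pA) s0.
rewrite -powRD; last by rewrite gt_eqF ?implybT.
by rewrite -[2^-1]mul1r -splitr powRr1 // ltW.
Qed.

(* A #_f B in the notation of Kubo and Ando, for a function f on the positive
   half-line that need not be operator monotone *)
Definition gmean f A B : H -> H :=
  pow_op A 2^-1
  \o fun_calc f (pow_op A (- 2^-1) \o B \o pow_op A (- 2^-1))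
  \o pow_op A 2^-1.

Lemma pos_op_relative A B : pos_op A -> pos_op B ->
  pos_op (pow_op A (- 2^-1) \o B \o pow_op A (- 2^-1)).
Proof.
move=> pA pB; have [_ pi i _] := pos_op_sqrt pA.
by apply: pos_op_conj pB; [exact: pos_op_bounded|exact: pos_op_symm|case: pi].
Qed.

Lemma pos_op_gmean f A B : pos_op A -> pos_op B -> continuous_pos f ->
  (forall s, 0 < s -> 0 < f s) -> pos_op (gmean f A B).
Proof.
move=> pA pB cf f0; have [pr _ _ _] := pos_op_sqrt pA.
apply: pos_op_conj; [exact: pos_op_bounded|exact: pos_op_symm|by case: pr|].
exact/pos_op_fun_calc/f0/cf/pos_op_relative.
Qed.

(* the square root of A may be replaced by any factorization A = K L, because
   K^-1 A^{1/2} = L A^{-1/2} conjugates A^{-1/2} B A^{-1/2} to K^-1 B L^-1 *)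
Lemma gmean_factor f A B K L Ki Li T : pos_op A -> pos_op B ->
  bounded_op K -> bounded_op L -> inverse_op K Ki -> inverse_op L Li ->
  A = K \o L -> is_fun_calc f (Ki \o B \o Li) T -> gmean f A B = K \o T \o L.
Proof.
move=> pA pB bK bL iK iL AKL fT.
have [pr pri ir rr] := pos_op_sqrt pA.
have pC := pos_op_relative pA pB.
set r := pow_op A 2^-1 in pr ir rr *; set ri := pow_op A (- 2^-1) in pri ir pC *.
have /inverse_opP[bKi KKi KiK] := iK; have /inverse_opP[bLi LLi LiL] := iL.
have /inverse_opP[bri rri rir] := ir.
have br := pos_op_bounded pr.
have WE x : Ki (r x) = L (ri x).
  have : A (ri x) = r x by rewrite -rr /= rri.
  by rewrite AKL /= => <-; rewrite KiK.
have iW : inverse_op (Ki \o r) (ri \o K).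
  by apply: inverse_op_comp ir; apply: inverse_op_sym.
have := is_fun_calc_similar (bounded_op_comp bKi br) iW fT.
have -> : ri \o K \o (Ki \o B \o Li) \o (Ki \o r) = ri \o B \o ri.
  by apply/funext => x; rewrite /= KKi WE LiL.
move=> /(fun_calcE hip (pos_op_bounded pC) (pos_op_symm pC)) e.
apply/funext => x; rewrite /gmean -/r -/ri e /= rri.
by rewrite WE rir.
Qed.

(** Both means are congruent, by the same square root, to functions of one operator, so a scalar
    inequality on its spectrum decides. *)
Lemma gmean_loewner f g A B : pos_op A -> pos_op B ->
  continuous_pos f -> continuous_pos g ->
  (forall s, spectrum (pow_op A (- 2^-1) \o B \o pow_op A (- 2^-1)) s ->
     f s <= g s) ->
  loewner ip (gmean f A B) (gmean g A B).
Proof.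
move=> pA pB cf cg fg; have pC := pos_op_relative pA pB.
have [pr _ _ _] := pos_op_sqrt pA.
have br := pos_op_bounded pr; have sr := pos_op_symm pr.
have bC := pos_op_bounded pC; have sC := pos_op_symm pC.
have fC := is_fun_calc_pos pC cf; have gC := is_fun_calc_pos pC cg.
have bf := is_fun_calc_bounded fC; have bg := is_fun_calc_bounded gC.
apply/loewnerP.
- exact/bounded_op_comp/br/bounded_op_comp.
- exact/symm_conj/(is_fun_calc_symm hip bC sC fC).
- exact/bounded_op_comp/br/bounded_op_comp.
- exact/symm_conj/(is_fun_calc_symm hip bC sC gC).
move=> x; rewrite /gmean /= !sr -subr_ge0 -ripBl.
have := is_fun_calc_ge hip bC sC (is_fun_calcD gC (is_fun_calcZ (-1) fC)) (c := 0).
move=> /(_ _ (pow_op A 2^-1 x)); rewrite mul0r !fctE rmorphN scaleN1r; apply.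
by move=> s /fg; rewrite mulN1r subr_ge0.
Qed.

(** Evaluate the forms of A and B at A^(-1/2) x: that of A becomes |x|^2. *)
Lemma relative_ge1 A B : pos_op A -> pos_op B -> loewner ip A B ->
  forall s, spectrum (pow_op A (- 2^-1) \o B \o pow_op A (- 2^-1)) s -> 1 <= s.
Proof.
move=> pA pB; have bA := pos_op_bounded pA; have bB := pos_op_bounded pB.
have sA := pos_op_symm pA; have sB := pos_op_symm pB.
move=> /(loewnerP bA sA bB sB) AB; have [pr pri ir rr] := pos_op_sqrt pA.
have pC := pos_op_relative pA pB.
have /inverse_opP[_ rri rir] := ir.
apply: (spectrum_ge hip (pos_op_bounded pC)) => x /=; rewrite mul1r.
rewrite (pos_op_symm pri) (le_trans _ (AB _)) // -{1}rr /= rri.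
by rewrite -(pos_op_symm pri) rir (rip_nr hip).
Qed.

Lemma relative_le1 A B : pos_op A -> pos_op B -> loewner ip B A ->
  forall s, spectrum (pow_op A (- 2^-1) \o B \o pow_op A (- 2^-1)) s -> s <= 1.
Proof.
move=> pA pB; have bA := pos_op_bounded pA; have bB := pos_op_bounded pB.
have sA := pos_op_symm pA; have sB := pos_op_symm pB.
move=> /(loewnerP bB sB bA sA) AB; have [pr pri ir rr] := pos_op_sqrt pA.
have pC := pos_op_relative pA pB.
have /inverse_opP[_ rri rir] := ir.
apply: (spectrum_le hip (pos_op_bounded pC)) => x /=; rewrite mul1r.
rewrite (pos_op_symm pri) (le_trans (AB _)) // -{1}rr /= rri.
by rewrite -(pos_op_symm pri) rir (rip_nr hip).
Qed.

Lemma gmean1 f A B : pos_op A -> pos_op B -> (forall s, 0 < s -> f s = 1) ->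
  gmean f A B = A.
Proof.
move=> pA pB f1; have pC := pos_op_relative pA pB; have [_ _ _ rr] := pos_op_sqrt pA.
rewrite /gmean (@fun_calcE _ _ _ hip _ (pos_op_bounded pC) (pos_op_symm pC) _ idfun) //.
rewrite -scalar_op1; apply: is_fun_calc_ext (is_fun_calc_const 1 (pos_op_bounded pC)).
by move=> s /(pos_op_spectrum_gt0 pC) /f1.
Qed.

Lemma gmean_id f A B : pos_op A -> pos_op B -> (forall s, 0 < s -> f s = s) ->
  gmean f A B = B.
Proof.
move=> pA pB f1; have pC := pos_op_relative pA pB; have [_ _ ir rr] := pos_op_sqrt pA.
have /inverse_opP[_ rri rir] := ir.
rewrite /gmean (@fun_calcE _ _ _ hip _ (pos_op_bounded pC) (pos_op_symm pC) _
  (pow_op A (- 2^-1) \o B \o pow_op A (- 2^-1))) //.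
  by apply/funext => x /=; rewrite rri rir.
apply: is_fun_calc_ext (is_fun_calc_id (pos_op_bounded pC)).
by move=> s /(pos_op_spectrum_gt0 pC) /f1.
Qed.

(** Links the operators X^(1/2) A^-1 X^(1/2) of the Karcher equation, and the inverted arguments of
    the case p < 0, to the operators X^(-1/2) A X^(-1/2) of [gmean]. *)
Lemma relative_inverse A B : pos_op A -> pos_op B ->
  [/\ pos_op (pow_op A 2^-1 \o inv_op B \o pow_op A 2^-1) &
      is_fun_calc (fun s => s^-1)
        (pow_op A (- 2^-1) \o B \o pow_op A (- 2^-1))
        (pow_op A 2^-1 \o inv_op B \o pow_op A 2^-1)].
Proof.
move=> pA pB; have [pr pri ir _] := pos_op_sqrt pA.
have pC := pos_op_relative pA pB.
have bC := pos_op_bounded pC; have sC := pos_op_symm pC.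
have br := pos_op_bounded pr; have iri := inverse_op_sym br ir.
split.
  by apply: pos_op_conj (pos_op_inv pB) => //; [exact: pos_op_symm|case: pr].
have h := is_fun_calc_pos pC
  (@continuous_pos_inv _ (fun s => s) (fun _ => id) (@continuous_pos_id R)).
have iC := is_fun_calc_inverse bC sC (is_fun_calc_id bC) h
  (fun s ss => mulfV (lt0r_neq0 (pos_op_spectrum_gt0 pC ss))).
have iC' := inverse_op_comp (inverse_op_comp iri (pos_op_inverse pB)) iri.
by rewrite -[X in is_fun_calc _ _ X](inverse_op_uniq iC iC').
Qed.

(** Factoring A^-1 as A^(-1/2) A^(-1/2) makes C^-1, with C = A^(-1/2) B A^(-1/2), the operator of
    B^-1 relative to A^-1. The two means are then f(C^-1) and g(C), inverse to each other, between
    mutually inverse outer factors. *)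
Lemma gmean_inverse f g A B : pos_op A -> pos_op B -> continuous_pos f ->
  continuous_pos g -> (forall s, 0 < s -> f s^-1 * g s = 1) ->
  inverse_op (gmean f (inv_op A) (inv_op B)) (gmean g A B).
Proof.
move=> pA pB cf cg fg; have [pC' invC] := relative_inverse pA pB.
have [pr pri ir rr] := pos_op_sqrt pA; have pC := pos_op_relative pA pB.
have bC := pos_op_bounded pC; have sC := pos_op_symm pC.
have br := pos_op_bounded pr; have bri := pos_op_bounded pri.
have iri := inverse_op_sym br ir.
have pAi := pos_op_inv pA; have pBi := pos_op_inv pB.
have Ai : inv_op A = pow_op A (- 2^-1) \o pow_op A (- 2^-1).
  by apply: inv_opE; rewrite -[in inverse_op A]rr; apply: inverse_op_comp.
have fC' := is_fun_calc_pos pC' cf.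
have fC := is_fun_calc_comp hip bC invC fC'.
have gC := is_fun_calc_pos pC cg.
rewrite (gmean_factor pAi pBi bri bri iri iri Ai fC').
have iT := is_fun_calc_inverse bC sC fC gC
  (fun s ss => fg s (pos_op_spectrum_gt0 pC ss)).
exact: (inverse_op_comp (inverse_op_comp iri iT) iri).
Qed.

Lemma gmean_solves f phi t kappa A B : pos_op A -> pos_op B ->
  continuous_pos f -> (forall s, 0 < s -> 0 < f s) -> continuous_pos phi ->
  (forall s, 0 < s ->
     (1 - t) * phi (f s)^-1 + t * phi (s * (f s)^-1) = kappa) ->
  (1 - t)%:C *: gmean phi (gmean f A B) A + t%:C *: gmean phi (gmean f A B) B
    = kappa%:C *: gmean f A B.
Proof.
move=> pA pB cf f0 cphi eqn.
have [pr pri ir rr] := pos_op_sqrt pA; have pC := pos_op_relative pA pB.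
have pF := pos_op_gmean pA pB cf f0.
have bC := pos_op_bounded pC; have sC := pos_op_symm pC.
have FE : gmean f A B = pow_op A 2^-1 \o
  fun_calc f (pow_op A (- 2^-1) \o B \o pow_op A (- 2^-1)) \o pow_op A 2^-1 by [].
set r := pow_op A 2^-1 in pr ir rr FE *.
set ri := pow_op A (- 2^-1) in pri ir pC bC sC FE *.
set C := ri \o B \o ri in pC bC sC FE *.
set F := gmean f A B in pF FE *.
have br := pos_op_bounded pr; have bri := pos_op_bounded pri.
have /inverse_opP[_ rri rir] := ir; have iri := inverse_op_sym br ir.
have fC := is_fun_calc_pos pC cf.
have pT := pos_op_fun_calc pC cf f0.
have [pd pdi id dd] := pos_op_sqrt pT.
set T := fun_calc f C in fC pT pd pdi id dd FE *.
set d := pow_op T 2^-1 in pd id dd; set di := pow_op T (- 2^-1) in pdi id.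
have bd := pos_op_bounded pd; have bdi := pos_op_bounded pdi.
have /inverse_opP[_ ddi did] := id; have idi := inverse_op_sym bd id.
have bT := pos_op_bounded pT; have sT := pos_op_symm pT.
have diC : is_fun_calc (fun s => f s `^ (- 2^-1)) C di.
  exact: (is_fun_calc_comp hip bC fC (is_fun_calc_pos pT (@continuous_pos_powR R (- 2^-1)))).
have f12 s : 0 < s -> f s `^ (- 2^-1) * f s `^ (- 2^-1) = (f s)^-1.
  move=> /f0 fs0; rewrite powRN -invfM -powRD; last by rewrite gt_eqF ?implybT.
  by rewrite -[2^-1]mul1r -splitr powRr1 // ltW.
(* Now K^-1 A L^-1 = d^-2 = f(C)^-1, and K^-1 B L^-1 = d^-1 C d^-1 is the function s / f(s) of C:
   the two arguments of phi in [eqn]. *)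
pose K := r \o d; pose L := d \o r; pose Ki := di \o ri; pose Li := ri \o di.
have bK : bounded_op K by apply: bounded_op_comp.
have bL : bounded_op L by apply: bounded_op_comp.
have iK : inverse_op K Ki by apply: inverse_op_comp.
have iL : inverse_op L Li by apply: inverse_op_comp.
have FKL : F = K \o L by rewrite FE -dd.
have relA : is_fun_calc (fun s => (f s)^-1) C (Ki \o A \o Li).
  have -> : Ki \o A \o Li = di \o di.
    by apply/funext => x; rewrite /Ki /Li /= -rr /= !rri rir.
  apply: is_fun_calc_ext (is_fun_calcM hip bC diC diC) => s.
  by move=> /(pos_op_spectrum_gt0 pC)/f12.
have relB : is_fun_calc (fun s => s * (f s)^-1) C (Ki \o B \o Li).
  have e := is_fun_calcM hip bC (is_fun_calcM hip bC diC (is_fun_calc_id bC)) diC.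
  apply: is_fun_calc_ext e => s /(pos_op_spectrum_gt0 pC) s0 /=.
  by rewrite mulrAC f12 // mulrC.
have pdc X : pos_op X -> pos_op (Ki \o X \o Li).
  move=> pX; have pX' := pos_op_conj bri (pos_op_symm pri) (proj2 pri) pX.
  exact: (pos_op_conj bdi (pos_op_symm pdi) (proj2 pdi) pX').
have hA := is_fun_calc_pos (pdc A pA) cphi.
have hB := is_fun_calc_pos (pdc B pB) cphi.
rewrite (gmean_factor pF pA bK bL iK iL FKL hA).
rewrite (gmean_factor pF pB bK bL iK iL FKL hB).
have hAC := is_fun_calc_comp hip bC relA hA.
have hBC := is_fun_calc_comp hip bC relB hB.
have key := is_fun_calcD (is_fun_calcZ (1 - t) hAC) (is_fun_calcZ t hBC).
have {key} := is_fun_calc_eq bC sC key (is_fun_calc_const kappa bC) _.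
move=> /(_ (fun s ss => eqn s (pos_op_spectrum_gt0 pC ss))) key.
apply/funext => x; have := congr1 (fun S => K (S (L x))) key.
rewrite /= !fctE /= scalar_opE (bounded_opD _ _ bK) !(bounded_opZ _ _ bK).
by rewrite FKL.
Qed.

(* psi inverts phi; the bounds [c, d] keep psi off the points where it is not
   continuous *)
Lemma gmean_unique f phi psi t kappa A B X : pos_op A -> pos_op B -> pos_op X ->
  t != 0 -> continuous_pos f -> continuous_pos phi ->
  (forall s, 0 < s -> psi (phi s) = s) ->
  (forall m M, 0 < m -> exists c d,
     (forall s, m <= s <= M -> c <= phi s <= d) /\
     (forall y : R, c <= y <= d -> {for y, continuous psi} /\ phi (psi y) = y)) ->
  (forall a b, 0 < a -> 0 < b -> (1 - t) * phi a + t * phi b = kappa ->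
     a * f (b / a) = 1) ->
  (1 - t)%:C *: gmean phi X A + t%:C *: gmean phi X B = kappa%:C *: X ->
  X = gmean f A B.
Proof.
move=> pA pB pX t0 cf cphi psiK rng eqn XE.
have [pr pri ir rr] := pos_op_sqrt pX.
have pA' := pos_op_relative pX pA; have pB' := pos_op_relative pX pB.
move: XE; rewrite /gmean.
set r := pow_op X 2^-1 in pr ir rr *.
set ri := pow_op X (- 2^-1) in pri ir pA' pB' *.
set A' := ri \o A \o ri in pA' *; set B' := ri \o B \o ri in pB' *.
move=> XE.
have br := pos_op_bounded pr; have bri := pos_op_bounded pri.
have /inverse_opP[_ rri rir] := ir.
have bA := pos_op_bounded pA'; have sA := pos_op_symm pA'.
have bB := pos_op_bounded pB'; have sB := pos_op_symm pB'.
have hU := is_fun_calc_pos pA' cphi; have hV := is_fun_calc_pos pB' cphi.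
set U := fun_calc phi A' in hU XE; set V := fun_calc phi B' in hV XE.
(* Conjugation by X^(-1/2) strips the outer square roots and leaves (1 - t) phi(A') + t phi(B') =
   kappa. *)
have UV y : (1 - t)%:C *: U y + t%:C *: V y = kappa%:C *: y.
  have := congr1 (fun S => ri (S (ri y))) XE.
  rewrite /= !fctE /= -{1}rr /= rri.
  by rewrite (bounded_opD _ _ bri) !(bounded_opZ _ _ bri) !rir.
have tC : t%:C != 0 by rewrite (inj_eq (@complexI _)).
(* [v] is the equation solved for phi(B'); it makes V = phi(B'), and then B' = psi(V), a function of
   A'. *)
pose v s := kappa / t + - ((1 - t) / t) * phi s.
have vV : is_fun_calc v A' V.
  have := is_fun_calcD (is_fun_calc_const (kappa / t) bA) (is_fun_calcZ (- ((1 - t) / t)) hU).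
  congr is_fun_calc; apply/funext => y; rewrite !fctE scalar_opE.
  apply: (scalerI tC); rewrite scalerDr !scalerA -!rmorphM.
  have -> : t * (kappa / t) = kappa by field.
  have -> : t * - ((1 - t) / t) = - (1 - t) by field.
  by rewrite -UV rmorphN scaleNr addrAC subrr add0r.
(* The spectrum of B' determines an interval [c, d] that contains the spectrum of V and on which psi
   is continuous. *)
have [m [M [m0 hm]]] := pos_op_spectrum pB'.
have [c [d [h1 h2]]] := rng m M m0.
have bV := is_fun_calc_bounded hV; have sV := is_fun_calc_symm hip bB sB hV.
have spV s : spectrum V s -> c <= s <= d.
  move=> ss; apply/andP; split.
    apply: (spectrum_ge hip bV _ ss); apply: (is_fun_calc_ge hip bB sB hV) => u.
    by move=> /hm /h1 /andP[].
  apply: (spectrum_le hip bV _ ss); apply: (is_fun_calc_le hip bB sB hV) => u.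
  by move=> /hm /h1 /andP[].
have psiV : is_fun_calc psi V B'.
  have h := is_fun_calc_continuous hip bV sV spV (fun s hs => proj1 (h2 s hs)).
  have e := is_fun_calc_eq bB sB (is_fun_calc_comp hip bB hV h) (is_fun_calc_id bB) _.
  rewrite -[in X in is_fun_calc _ _ X]e // => s /(pos_op_spectrum_gt0 pB').
  exact: psiK.
have vB : is_fun_calc (psi \o v) A' B' := is_fun_calc_comp hip bA vV psiV.
(* By spectral mapping psi (v s) is a spectral value of B', hence positive, and the pair (s, psi (v
   s)) satisfies the scalar equation. *)
have eqA s : spectrum A' s -> 0 < psi (v s) /\ s * f (psi (v s) / s) = 1.
  move=> ss; have s0 := pos_op_spectrum_gt0 pA' ss.
  have b0 := pos_op_spectrum_gt0 pB' (spectrum_map bA vB ss).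
  split=> //; apply: eqn => //.
  rewrite (proj2 (h2 _ (spV _ (spectrum_map bA vV ss)))) /v; field.
  exact: t0.
have [pa pai ia aa] := pos_op_sqrt pA'.
have ca := is_fun_calc_pos pA' (@continuous_pos_powR R 2^-1).
have cai := is_fun_calc_pos pA' (@continuous_pos_powR R (- 2^-1)).
rewrite -/(pow_op A' 2^-1) in ca; rewrite -/(pow_op A' (- 2^-1)) in cai.
set a := pow_op A' 2^-1 in pa ia aa ca; set ai := pow_op A' (- 2^-1) in pai ia cai.
have ba := pos_op_bounded pa; have bai := pos_op_bounded pai.
(* Here A = K L and K^-1 B L^-1 = a^-1 B' a^-1 is the function psi(v(s)) / s of A'. The identity of
   [eqA] becomes a f(a^-1 B' a^-1) a = 1, and conjugating by r gives gmean f A B = r r = X. *)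
pose K := r \o a; pose L := a \o r; pose Ki := ai \o ri; pose Li := ri \o ai.
have bK : bounded_op K by apply: bounded_op_comp.
have bL : bounded_op L by apply: bounded_op_comp.
have iK : inverse_op K Ki by apply: inverse_op_comp.
have iL : inverse_op L Li by apply: inverse_op_comp.
have AKL : A = K \o L.
  have -> : K \o L = r \o (a \o a) \o r by [].
  by rewrite aa; apply/funext => x; rewrite /A' /= rir rri.
have pD : pos_op (ai \o B' \o ai).
  exact: (pos_op_conj bai (pos_op_symm pai) (proj2 pai) pB').
have hD := is_fun_calc_pos pD cf.
have relB := is_fun_calcM hip bA (is_fun_calcM hip bA cai vB) cai.
have hDA := is_fun_calc_comp hip bA relB hD.
have aDa := is_fun_calcM hip bA (is_fun_calcM hip bA ca hDA) ca.
have e1 := is_fun_calc_eq bA sA aDa (is_fun_calc_const 1 bA) _.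
have e2 : a \o fun_calc f (ai \o B' \o ai) \o a = idfun.
  rewrite -scalar_op1; apply: e1 => s ss /=; have [b0 e] := eqA s ss.
  have s0 := pos_op_spectrum_gt0 pA' ss.
  have ss12 : s `^ 2^-1 * s `^ 2^-1 = s.
    rewrite -powRD; last by rewrite gt_eqF ?implybT.
    by rewrite -[2^-1]mul1r -splitr powRr1 // ltW.
  rewrite mulrAC ss12 mulrAC powRN -invfM ss12 mulrC.
  by rewrite [_^-1 * _]mulrC mulrC.
have := gmean_factor pA pB bK bL iK iL AKL hD.
rewrite /gmean => ->; rewrite -[LHS]rr; apply/funext => x.
have := congr1 (fun S => r (S (r x))) e2.
by rewrite /K /L /= => ->.
Qed.

End GeneralizedMeans.

(** * Scalar power means *)

Section ScalarPowerMean.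
Variable R : realType.
Implicit Types (a b p s t : R).

Lemma powRV s p : 0 <= s -> s^-1 `^ p = (s `^ p)^-1.
Proof. by move=> s0; rewrite -powR_inv1 // -powRrM mulN1r powRN. Qed.

(** The endpoint conventions agree with the general formula, so that monotonicity on the closed
    interval requires no case analysis on t. *)
Lemma scalar_power_mean2E p t a b : 0 < a -> 0 < b ->
  scalar_power_mean2 p t a b =
    if p == 0 then a `^ (1 - t) * b `^ t
    else ((1 - t) * a `^ p + t * b `^ p) `^ p^-1.
Proof.
move=> a0 b0; rewrite /scalar_power_mean2 /scalar_power_mean.
rewrite !big_ord_recl !big_ord0 /pair_fun /= addr0 mulr1.
have [->|_] := eqVneq t 0.
  rewrite subr0 mul1r mul0r addr0 powRr1 ?(ltW a0) // powRr0 mulr1.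
  by case: eqVneq => // p0; rewrite -powRrM mulfV // powRr1 // ltW.
have [->|_ //] := eqVneq t 1.
rewrite subrr mul1r mul0r add0r powRr1 ?(ltW b0) // powRr0 mul1r.
by case: eqVneq => // p0; rewrite -powRrM mulfV // powRr1 // ltW.
Qed.

Lemma scalar_power_mean2C p t a b : 0 < a -> 0 < b ->
  scalar_power_mean2 p t a b = scalar_power_mean2 p (1 - t) b a.
Proof.
move=> a0 b0.
rewrite (scalar_power_mean2E p t a0 b0) (scalar_power_mean2E p (1 - t) b0 a0).
have -> : 1 - (1 - t) = t by ring.
case: (p == 0); first exact: mulrC.
by rewrite (addrC (t * _)).
Qed.

Lemma convex_comb_gt0 t a b : 0 <= t <= 1 -> 0 < a -> 0 < b ->
  0 < (1 - t) * a + t * b.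
Proof. by move=> /andP[t0 t1] a0 b0; nra. Qed.

Lemma scalar_power_mean2_gt0 p t a b : 0 <= t <= 1 -> 0 < a -> 0 < b ->
  0 < scalar_power_mean2 p t a b.
Proof.
move=> t01 a0 b0; rewrite scalar_power_mean2E //; case: ifP => _.
  by rewrite mulr_gt0 // powR_gt0.
by rewrite powR_gt0 // convex_comb_gt0 // powR_gt0.
Qed.

(** For p = 0 the mean is a (b / a)^t with b / a >= 1. For p < 0 the sum of p-th powers decreases
    with t, and the outer power 1 / p reverses the order once more. *)
Lemma scalar_power_mean2_le p s t a b : 0 <= s -> s <= t -> t <= 1 ->
  0 < a -> a <= b -> scalar_power_mean2 p s a b <= scalar_power_mean2 p t a b.
Proof.
move=> s0 st t1 a0 ab; have b0 := lt_le_trans a0 ab.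
have s01 : 0 <= s <= 1 by rewrite s0 (le_trans st).
have t01 : 0 <= t <= 1 by rewrite t1 (le_trans s0).
rewrite !scalar_power_mean2E //; case: eqVneq => [_|p0].
  have e u : a `^ (1 - u) * b `^ u = a * (b / a) `^ u.
    rewrite powRB ?powRr1 ?(ltW a0) //; last by rewrite (gt_eqF a0) implybT.
    by rewrite powRM ?powRV ?invr_ge0 ?(ltW a0) ?(ltW b0) //; ring.
  by rewrite !e ler_wpM2l ?(ltW a0) // ler_powR // ler_pdivlMr // mul1r.
have ap := powR_gt0 p a0; have bp := powR_gt0 p b0.
have [p_lt0|p_gt0|p00] := ltgtP p 0; last by rewrite p00 eqxx in p0.
  have q0 : 0 <= (- p)^-1 by rewrite invr_ge0 oppr_ge0 ltW.
  have ba : b `^ p <= a `^ p.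
    rewrite -[p]opprK !(powRN _ (- p)) lef_pV2 ?posrE ?powR_gt0 //.
    by apply: ge0_ler_powR => //; rewrite ?nnegrE ?oppr_ge0 ltW.
  have N : p^-1 = - (- p)^-1 by rewrite invrN opprK.
  rewrite N !(powRN _ (- p)^-1) lef_pV2 ?posrE ?powR_gt0 ?convex_comb_gt0 //.
  apply: (ge0_ler_powR q0); rewrite ?nnegrE.
  - by apply/ltW/convex_comb_gt0.
  - by apply/ltW/convex_comb_gt0.
  by nra.
have ba : a `^ p <= b `^ p by apply: ge0_ler_powR => //; rewrite ?nnegrE ltW.
have q0 : 0 <= p^-1 by rewrite invr_ge0 ltW.
apply: (ge0_ler_powR q0); rewrite ?nnegrE.
- by apply/ltW/convex_comb_gt0.
- by apply/ltW/convex_comb_gt0.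
by nra.
Qed.

Lemma scalar_power_mean2_ge p s t a b : 0 <= s -> s <= t -> t <= 1 ->
  0 < b -> b <= a -> scalar_power_mean2 p t a b <= scalar_power_mean2 p s a b.
Proof.
move=> s0 st t1 b0 ba; have a0 := lt_le_trans b0 ba.
rewrite (scalar_power_mean2C p t a0 b0) (scalar_power_mean2C p s a0 b0).
by apply: (scalar_power_mean2_le _ _ _ _ b0 ba); lra.
Qed.

Lemma scalar_power_mean2_1 p t s : 0 < s -> scalar_power_mean2 p t 1 s =
  if p == 0 then s `^ t else ((1 - t) + t * s `^ p) `^ p^-1.
Proof.
move=> s0; rewrite scalar_power_mean2E //.
by rewrite powR1 /= mul1r mulr1.
Qed.

Lemma continuous_pos_scalar_power_mean2 p t : 0 <= t <= 1 ->
  continuous_pos (scalar_power_mean2 p t 1).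
Proof.
move=> t01 s s0.
pose g u := if p == 0 then u `^ t else ((1 - t) + t * u `^ p) `^ p^-1.
have : {for s, continuous g}.
  rewrite /g; case: eqP => _; first exact: continuous_pos_powR.
  apply: (@continuous_pos_comp R (fun u => (1 - t) + t * u `^ p) (fun u => u `^ p^-1)) => //.
  - by move=> u u0; rewrite -[1 - t]mulr1 convex_comb_gt0 // powR_gt0.
  - apply: continuous_posD; first exact: continuous_pos_cst.
    by apply: continuous_posM (@continuous_pos_powR R p); apply: continuous_pos_cst.
  - exact: continuous_pos_powR.
rewrite /prop_for /continuous_at scalar_power_mean2_1 // -/(g s).
(* The closed form g is known at positive arguments only, which suffices in a neighbourhood of s >
   0. *)
apply: cvg_trans; apply: near_eq_cvg.
near=> u; rewrite scalar_power_mean2_1 //; near: u.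
exact: lt_nbhsr.
Unshelve. all: by end_near. Qed.

Lemma scalar_power_mean2_solves p t s : 0 < p -> 0 <= t <= 1 -> 0 < s ->
  (1 - t) * (scalar_power_mean2 p t 1 s)^-1 `^ p
  + t * (s * (scalar_power_mean2 p t 1 s)^-1) `^ p = 1.
Proof.
move=> p0 t01 s0; have f0 := scalar_power_mean2_gt0 p t01 ltr01 s0.
rewrite powRM ?invr_ge0 ?ltW // powRV ?ltW //.
rewrite scalar_power_mean2_1 // (gt_eqF p0) -powRrM mulVf ?gt_eqF //.
have N0 : 0 < 1 - t + t * s `^ p.
  by rewrite -[1 - t]mulr1 convex_comb_gt0 // powR_gt0.
by rewrite powRr1 ?(ltW N0) //; field; rewrite gt_eqF.
Qed.

(** By homogeneity the left-hand side is the power mean of a and b, whose p-th power the equation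
    sets to 1. It is the scalar input to uniqueness. *)
Lemma scalar_power_mean2_normalized p t a b : 0 < p -> 0 < a -> 0 < b ->
  (1 - t) * a `^ p + t * b `^ p = 1 ->
  a * scalar_power_mean2 p t 1 (b / a) = 1.
Proof.
move=> p0 a0 b0 e; rewrite scalar_power_mean2_1 ?divr_gt0 // (gt_eqF p0).
rewrite powRM ?invr_ge0 ?ltW // powRV ?ltW //.
have ap := powR_gt0 p a0.
have -> : 1 - t + t * (b `^ p / a `^ p) = (a `^ p)^-1.
  apply: (mulIf (lt0r_neq0 ap)); rewrite mulVf ?gt_eqF // -[RHS]e.
  by rewrite mulrDl -mulrA divfK ?gt_eqF.
rewrite powRV ?powR_ge0 // -powRrM mulfV ?gt_eqF // powRr1 ?(ltW a0) //.
by rewrite mulfV // gt_eqF.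
Qed.

Lemma scalar_power_mean2_dual p t s : 0 <= t <= 1 -> 0 < s ->
  scalar_power_mean2 (- p) t 1 s^-1 * scalar_power_mean2 p t 1 s = 1.
Proof.
move=> t01 s0; rewrite !scalar_power_mean2_1 ?invr_gt0 // oppr_eq0.
case: (p == 0).
  by rewrite powRV ?(ltW s0) // mulVf // gt_eqF // powR_gt0.
rewrite (powRV (- p) (ltW s0)) (powRN s p) invrK.
rewrite invrN powRN mulVf // gt_eqF // powR_gt0 //.
by rewrite -[1 - t]mulr1 convex_comb_gt0 // powR_gt0.
Qed.

End ScalarPowerMean.

(** * Power means of two operators *)

Section PowerMeans.
Variables (R : realType) (H : completeNormedModType R[i]).
Implicit Types (x y z : H) (a b c d e s t m M p : R) (A B C S T U X : H -> H).
Variable ip : {dot H for Num.conj}.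
Hypothesis hip : induces_norm ip.
Local Notation rip := (rip ip).
Local Notation symm := (symm ip).
Local Notation pos_op := (pos_op ip).

Lemma big_pair_fun (V : nmodType) (F : 'I_2 -> V) :
  \sum_(i < 2) F i = F ord0 + F (lift ord0 ord0).
Proof. by rewrite !big_ord_recl big_ord0 addr0. Qed.

(** [geom_mean p] unfolds to [gmean] of the p-th power; the factor [1%:C] is the kappa of the shape
    shared with the Karcher equation, where kappa = 0. *)
Lemma is_power_meanE p t A B X : is_power_mean ip p (pair_fun (1 - t) t)
    (pair_fun A B) X <-> pos_op X /\
  (1 - t)%:C *: gmean (fun s => s `^ p) X A
  + t%:C *: gmean (fun s => s `^ p) X B = 1%:C *: X.
Proof.
rewrite /is_power_mean big_pair_fun /pair_fun /=.
have -> : 1%:C *: X = X by apply/funext => x; rewrite !fctE scale1r.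
by split=> -[pX e]; split.
Qed.

Lemma power_range p m M : 0 < p -> 0 < m -> exists c d,
  (forall s, m <= s <= M -> c <= s `^ p <= d) /\
  (forall y : R, c <= y <= d ->
     {for y, continuous (fun s => s `^ p^-1)} /\ (y `^ p^-1) `^ p = y).
Proof.
move=> p0 m0; exists (m `^ p), (M `^ p); split=> [s /andP[ms sM]|y /andP[my _]].
  have s0 := lt_le_trans m0 ms; have M0 := lt_le_trans s0 sM.
  have h := ge0_ler_powR (ltW p0).
  by apply/andP; split; apply: h => //; rewrite nnegrE ltW.
have y0 : 0 < y by apply: lt_le_trans my; apply: powR_gt0.
split; first exact: continuous_pos_powR.
by rewrite -powRrM mulVf ?gt_eqF // powRr1 // ltW.
Qed.

Lemma ln_range m M : 0 < m -> exists c d,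
  (forall s : R, m <= s <= M -> c <= ln s <= d) /\
  (forall y : R, c <= y <= d -> {for y, continuous expR} /\ ln (expR y) = y).
Proof.
move=> m0; exists (ln m), (ln M); split=> [s /andP[ms sM]|y _].
  have s0 := lt_le_trans m0 ms; have M0 := lt_le_trans s0 sM.
  by rewrite !ler_ln ?posrE // ms sM.
by split; [exact: continuous_expR|exact: expRK].
Qed.

Lemma power_mean_pos p t A B : 0 < p -> 0 < t < 1 -> pos_op A -> pos_op B ->
  xget 0 [set X | is_power_mean ip p (pair_fun (1 - t) t) (pair_fun A B) X]
  = gmean (scalar_power_mean2 p t 1) A B.
Proof.
move=> p0 /andP[t0 t1] pA pB; have t01 : 0 <= t <= 1 by rewrite !ltW.
have cf := @continuous_pos_scalar_power_mean2 R p t t01.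
have f0 s : 0 < s -> 0 < scalar_power_mean2 p t 1 s.
  exact: scalar_power_mean2_gt0.
apply: xget_unique => [|X].
  apply/is_power_meanE; split; first exact: pos_op_gmean.
  apply: gmean_solves => //; first exact: continuous_pos_powR.
  by move=> s; apply: scalar_power_mean2_solves.
move=> /is_power_meanE[pX XE].
apply: (@gmean_unique _ _ _ hip _ (fun s => s `^ p) (fun s => s `^ p^-1) t 1) => //.
- by rewrite gt_eqF.
- exact: continuous_pos_powR.
- by move=> s s0; rewrite -powRrM mulfV ?gt_eqF // powRr1 // ltW.
- by move=> m M; apply: power_range.
- by move=> a b; apply: scalar_power_mean2_normalized.
Qed.

Lemma log_op_relative A X : pos_op A -> pos_op X ->
  log_op (pow_op X 2^-1 \o inv_op A \o pow_op X 2^-1) =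
  (-1)%:C *: log_op (pow_op X (- 2^-1) \o A \o pow_op X (- 2^-1)).
Proof.
move=> pA pX; have [pC' iC] := relative_inverse hip pX pA.
have pC := pos_op_relative hip pX pA.
have bC := pos_op_bounded hip pC; have sC := pos_op_symm hip pC.
have h1 := is_fun_calc_comp hip bC iC (is_fun_calc_pos hip pC' (@continuous_pos_ln R)).
have h2 := is_fun_calcZ (-1) (is_fun_calc_pos hip pC (@continuous_pos_ln R)).
apply: (is_fun_calc_eq hip bC sC h1 h2) => s /(pos_op_spectrum_gt0 hip pC) s0.
by rewrite /= lnV ?posrE // mulN1r.
Qed.

(** The Karcher equation involves inverse relative operators, so its logarithms change sign, and it
    lacks the outer factors X^(1/2), which may be added or removed since they are invertible. *)
Lemma is_karcher_meanE t A B X : pos_op A -> pos_op B ->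
  is_karcher_mean ip (pair_fun (1 - t) t) (pair_fun A B) X <-> pos_op X /\
  (1 - t)%:C *: gmean (@ln R) X A + t%:C *: gmean (@ln R) X B = 0%:C *: X.
Proof.
move=> pA pB; rewrite /is_karcher_mean big_pair_fun /pair_fun /=.
split=> -[pX]; rewrite !log_op_relative //.
  move=> e; split=> //; have [pr _ _ _] := pos_op_sqrt hip pX.
  have br := pos_op_bounded hip pr.
  apply/funext => x; rewrite !fctE /gmean /= -!(bounded_opZ _ _ br) -(bounded_opD _ _ br).
  have := congr1 (fun S => - S (pow_op X 2^-1 x)) e.
  rewrite !fctE rmorphN scale0r oppr0 !scaleN1r !scalerN -opprD opprK => ->.
  exact: bounded_op0.
move=> e; split=> //; have [pr pri ir _] := pos_op_sqrt hip pX.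
have bri := pos_op_bounded hip pri; have /inverse_opP[_ rri rir] := ir.
apply/funext => x; have := congr1 (fun S => - pow_op X (- 2^-1) (S (pow_op X (- 2^-1) x))) e.
rewrite !fctE /gmean /= (bounded_opD _ _ bri) !(bounded_opZ _ _ bri) !rir !rri.
by rewrite rmorphN !scaleN1r !scalerN -opprD scale0r oppr0.
Qed.

Lemma karcher_meanE t A B : 0 < t < 1 -> pos_op A -> pos_op B ->
  xget 0 [set X | is_karcher_mean ip (pair_fun (1 - t) t) (pair_fun A B) X]
  = gmean (scalar_power_mean2 0 t 1) A B.
Proof.
move=> /andP[t0 t1] pA pB; have t01 : 0 <= t <= 1 by rewrite !ltW.
have cf := @continuous_pos_scalar_power_mean2 R 0 t t01.
have f0 s : 0 < s -> 0 < scalar_power_mean2 0 t 1 s.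
  exact: scalar_power_mean2_gt0.
have lnf s : 0 < s -> ln (scalar_power_mean2 0 t 1 s) = t * ln s.
  by move=> s0; rewrite scalar_power_mean2_1 // eqxx ln_powR.
apply: xget_unique => [|X].
  apply/is_karcher_meanE => //; split; first exact: pos_op_gmean.
  apply: gmean_solves => //; first exact: continuous_pos_ln.
  move=> s s0; have fs := f0 s s0.
  by rewrite lnM ?posrE ?invr_gt0 // lnV ?posrE // lnf //; ring.
move=> /(is_karcher_meanE _ _ pA pB)[pX XE].
apply: (@gmean_unique _ _ _ hip _ (@ln R) expR t 0) => //.
- by rewrite gt_eqF.
- exact: continuous_pos_ln.
- by move=> s s0; rewrite lnK // posrE.
- exact: ln_range.
move=> a b a0 b0 e; have ba : 0 < b / a by rewrite divr_gt0.
apply: ln_inj; rewrite ?posrE ?mulr_gt0 ?f0 //.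
rewrite lnM ?posrE ?f0 // lnf // ln_div ?posrE // ln1 -e; ring.
Qed.

(** The conventions at t = 0 and t = 1 fit as well: there f is 1 or the identity and [gmean] returns
    A or B. *)
Lemma power_mean2_gmean p t A B : 0 <= t <= 1 -> pos_op A -> pos_op B ->
  power_mean2 ip p t A B = gmean (scalar_power_mean2 p t 1) A B.
Proof.
move=> t01 pA pB; rewrite /power_mean2.
have [->|t0] := eqVneq t 0.
  by rewrite (gmean1 hip pA pB) // => s s0; rewrite /scalar_power_mean2 eqxx.
have [->|t1] := eqVneq t 1.
  by rewrite (gmean_id hip pA pB) // => s s0; rewrite /scalar_power_mean2 eqxx oner_eq0.
have t01' : 0 < t < 1 by rewrite !lt_neqAle eq_sym t0 t1.
rewrite /power_mean; have [p0|p0] := ltP 0 p; first exact: power_mean_pos.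
have [pn|pn] := ltP p 0; last first.
  have -> : p = 0 by apply/eqP; rewrite eq_le p0.
  exact: karcher_meanE.
have -> : (fun i => inv_op (pair_fun A B i)) = pair_fun (inv_op A) (inv_op B).
  by apply/funext => i; rewrite /pair_fun; case: (i == ord0).
rewrite power_mean_pos ?oppr_gt0 //; try exact: pos_op_inv.
apply: inv_opE; apply: gmean_inverse => //.
- exact: continuous_pos_scalar_power_mean2.
- exact: continuous_pos_scalar_power_mean2.
- by move=> s; apply: scalar_power_mean2_dual.
Qed.

Lemma power_mean2_increasing p A B : pos_op A -> pos_op B -> loewner ip A B ->
  increasing_path ip (fun t => power_mean2 ip p t A B).
Proof.
move=> pA pB AB s t s0 st t1.
have s01 : 0 <= s <= 1 by rewrite s0 (le_trans st).
have t01 : 0 <= t <= 1 by rewrite t1 (le_trans s0).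
rewrite !power_mean2_gmean //; apply: gmean_loewner => //.
- exact: continuous_pos_scalar_power_mean2.
- exact: continuous_pos_scalar_power_mean2.
move=> u /(relative_ge1 hip pA pB AB) u1.
exact: (scalar_power_mean2_le p s0 st t1 ltr01 u1).
Qed.

Lemma power_mean2_decreasing p A B : pos_op A -> pos_op B -> loewner ip B A ->
  decreasing_path ip (fun t => power_mean2 ip p t A B).
Proof.
move=> pA pB BA s t s0 st t1.
have s01 : 0 <= s <= 1 by rewrite s0 (le_trans st).
have t01 : 0 <= t <= 1 by rewrite t1 (le_trans s0).
rewrite !power_mean2_gmean //; apply: gmean_loewner => //.
- exact: continuous_pos_scalar_power_mean2.
- exact: continuous_pos_scalar_power_mean2.
move=> u uC; have u0 := pos_op_spectrum_gt0 hip (pos_op_relative hip pA pB) uC.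
exact: (scalar_power_mean2_ge p s0 st t1 u0 (relative_le1 hip pA pB BA uC)).
Qed.

End PowerMeans.

(** * Parameterized ordered means *)

Section ParameterizedMeans.
Variables (R : realType) (H : completeNormedModType R[i]).
Variable ip : {dot H for Num.conj}.
Hypothesis hip : induces_norm ip.
Local Notation rip := (rip ip).
Local Notation symm := (symm ip).
Local Notation pos_op := (pos_op ip).
Implicit Types (x y : H) (a b c s t m : R) (S T U : H -> H).

Lemma loewner_refl T : loewner ip T T.
Proof.
rewrite /loewner subrr; apply/psd_opP; split=> [|x y|x].
- exact: bounded_op_zero.
- by rewrite rip0l ripC rip0l.
- by rewrite rip0l.
Qed.

Lemma psd_op_add S T : psd_op ip S -> psd_op ip T -> psd_op ip (S + T).
Proof.
move=> /psd_opP[bS sS S0] /psd_opP[bT sT T0]; apply/psd_opP.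
split=> [||x]; [exact: bounded_op_add|exact: symm_add|].
by rewrite !fctE ripDl addr_ge0.
Qed.

Lemma loewner_trans T S U : loewner ip S T -> loewner ip T U -> loewner ip S U.
Proof.
move=> ST TU; rewrite /loewner (_ : U - S = (U - T) + (T - S)).
  exact: psd_op_add.
by rewrite addrA subrK.
Qed.

Lemma loewnerD S T U V : loewner ip S T -> loewner ip U V ->
  loewner ip (S + U) (T + V).
Proof.
move=> ST UV; rewrite /loewner opprD addrACA.
exact: psd_op_add.
Qed.

Lemma loewner_subl S T U : loewner ip (S + U) T -> loewner ip S (T - U).
Proof. by rewrite /loewner opprD addrA addrAC. Qed.

Lemma pos_op_loewner S T : pos_op S -> loewner ip S T -> pos_op T.
Proof.
move=> /(pos_opP hip)[bS sS [c c0 hc]] /psd_opP[bD sD D0].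
have e : T = S + (T - S) by rewrite addrC subrK.
rewrite e; apply/(pos_opP hip); split; [exact: bounded_op_add|exact: symm_add|].
exists c => // x; rewrite !fctE ripDl (le_trans (hc x)) // lerDl.
exact: D0.
Qed.

Lemma pos_op_scale a T : 0 < a -> pos_op T -> pos_op (a%:C *: T).
Proof.
move=> a0 /(pos_opP hip)[bT sT [c c0 hc]]; apply/(pos_opP hip).
split; [exact: bounded_op_scale|exact: symm_scale|].
exists (a * c) => [|x]; first exact: mulr_gt0.
by rewrite !fctE ripZl -mulrA ler_wpM2l // ltW.
Qed.

Lemma pos_op_add S T : pos_op S -> pos_op T -> pos_op (S + T).
Proof.
move=> pS [pT _]; apply: (pos_op_loewner pS).
by rewrite /loewner addrC addKr.
Qed.

Lemma scalar_op_inverse c : c != 0 ->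
  inverse_op (scalar_op c : H -> H) (scalar_op c^-1).
Proof.
move=> c0; apply/inverse_opP; split=> [|x|x]; first exact: bounded_op_scalar.
  by rewrite !scalar_opE scalerA -rmorphM mulfV // scale1r.
by rewrite !scalar_opE scalerA -rmorphM mulVf // scale1r.
Qed.

Lemma pos_op_scalar c : 0 < c -> pos_op (scalar_op c).
Proof.
move=> c0; apply/(pos_opP hip).
split; [exact: bounded_op_scalar|exact: symm_scalar|].
by exists c => // x; rewrite scalar_opE ripZl (rip_nr hip).
Qed.

Variable G : forall n : nat, ('I_n -> R) -> ('I_n -> H -> H) -> H -> H.
Hypothesis hG : ordered_mean ip G.
Variables (n : nat) (w : 'I_n -> R).
Hypothesis hw : pos_prob_vec w.
Implicit Types A B : 'I_n -> H -> H.

(** The harmonic lower bound of [om_agh] at a constant family of scalars equals that scalar, as the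
    weights sum to 1. *)
Lemma ordered_mean_scalar c : 0 < c ->
  loewner ip (scalar_op c) (G w (fun=> scalar_op c)).
Proof.
move=> c0; have cn0 : c != 0 by rewrite gt_eqF.
have [h _] := om_agh hG hw (fun=> pos_op_scalar c0).
move: h; rewrite (inv_opE (scalar_op_inverse cn0)) -scaler_suml -rmorph_sum.
rewrite (proj2 hw) scale1r.
by rewrite (inv_opE (scalar_op_inverse (invr_neq0 cn0))) invrK.
Qed.

(* concavity at s = 1/2 combined with homogeneity *)
Lemma ordered_mean_superadditive A B :
  (forall i, pos_op (A i)) -> (forall i, pos_op (B i)) ->
  loewner ip (G w A + G w B) (G w (fun i => A i + B i)).
Proof.
move=> pA pB; have two : 0 < 2 :> R by [].
have half S : (1 / 2)%:C *: (2%:C *: S) = S :> (H -> H).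
  apply/funext => x; rewrite !fctE scalerA -rmorphM.
  by rewrite (_ : 1 / 2 * 2 = 1 :> R) ?scale1r //; field.
have h01 : 0 <= (1 / 2 : R) <= 1 by apply/andP; split; lra.
have := om_concave hG hw (fun i => pos_op_scale two (pA i))
  (fun i => pos_op_scale two (pB i)) h01.
rewrite (om_homogeneous hG hw pA two) (om_homogeneous hG hw pB two).
rewrite (_ : 1 - 1 / 2 = 1 / 2 :> R); last by field.
rewrite !half; congr (loewner _ _ (G w _)).
by apply/funext => i; rewrite !half.
Qed.

Lemma pos_op_shift A m : 0 < m -> (forall i, pos_op (A i)) ->
  forall i, pos_op (A i + scalar_op m).
Proof. by move=> m0 pA i; apply: pos_op_add (pos_op_scalar m0). Qed.

Lemma ordered_mean_shift A m : 0 < m -> (forall i, pos_op (A i)) ->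
  loewner ip (G w A + scalar_op m) (G w (fun i => A i + scalar_op m)).
Proof.
move=> m0 pA.
apply: (loewner_trans (T := G w A + G w (fun=> scalar_op m))).
  by apply: loewnerD (ordered_mean_scalar m0); apply: loewner_refl.
by apply: ordered_mean_superadditive => // i; apply: pos_op_scalar.
Qed.

(** Subtracting the scalar m does not leave the cone, because the result still dominates G(A). *)
Lemma pos_op_param_mean A m : 0 < m -> (forall i, pos_op (A i)) ->
  pos_op (param_mean G m w A).
Proof.
move=> m0 pA; apply: (pos_op_loewner (om_pos hG hw pA)).
exact/loewner_subl/ordered_mean_shift.
Qed.

Lemma param_mean_le A m m' : 0 < m -> m <= m' -> (forall i, pos_op (A i)) ->
  loewner ip (param_mean G m w A) (param_mean G m' w A).
Proof.
move=> m0; rewrite le_eqVlt => /orP[/eqP <- _|mm' pA]; first exact: loewner_refl.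
have d0 : 0 < m' - m by rewrite subr_gt0.
have scalarD a b : scalar_op (a + b) = scalar_op a + scalar_op b :> (H -> H).
  by apply/funext => x; rewrite !fctE !scalar_opE rmorphD scalerDl.
have := ordered_mean_shift d0 (pos_op_shift m0 pA).
rewrite (_ : (fun i => A i + scalar_op m + scalar_op (m' - m)) =
             (fun i => A i + scalar_op m')); last first.
  by apply/funext => i; rewrite -addrA -scalarD [m + _]addrC subrK.
move=> h; apply: loewner_subl; rewrite /param_mean.
rewrite -addrA (_ : - scalar_op m + scalar_op m' = scalar_op (m' - m)) //.
by apply: (addrI (scalar_op m)); rewrite addrA subrr add0r -scalarD [m + _]addrC subrK.
Qed.

End ParameterizedMeans.

Theorem mainTheorem6 (R : realType) (H : completeNormedModType R[i])
  (ip : {dot H for Num.conj}) (hip : induces_norm ip)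
  (G : forall n : nat, ('I_n -> R) -> ('I_n -> H -> H) -> H -> H)
  (hG : ordered_mean ip G)
  (n : nat) (A : 'I_n -> H -> H) (hA : forall i : 'I_n, pos_op ip (A i))
  (w : 'I_n -> R) (hw : pos_prob_vec w)
  (p : R) (hp : -1 <= p <= 1)
  (mu nu : R) (hmu : 0 < mu) (hnu : 0 < nu) :
  interpolates_monotonically ip mu nu
    (param_mean G mu w A) (param_mean G nu w A)
    (fun t : R => param_mean G (scalar_power_mean2 p t mu nu) w A)
  /\
  interpolates_monotonically ip mu nu
    (param_mean G mu w A) (param_mean G nu w A)
    (fun t : R => power_mean2 ip p t (param_mean G mu w A) (param_mean G nu w A)).
Proof.
have pmu := pos_op_param_mean hip hG hw hmu hA.
have pnu := pos_op_param_mean hip hG hw hnu hA.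
have le_param := param_mean_le hip hG hw.
split; split.
- by rewrite /scalar_power_mean2 eqxx.
- by rewrite /scalar_power_mean2 oner_eq0 eqxx.
(* The scalar mean is the parameter here, so its monotonicity passes to the operators; [le_param]
   asks for positivity of the smaller parameter, the one at s here and the one at t in the
   decreasing case. *)
- move=> mn s t s0 st t1; apply: le_param => //.
    by apply: scalar_power_mean2_gt0 => //; rewrite s0 (le_trans st).
  exact: scalar_power_mean2_le.
- move=> nm s t s0 st t1; apply: le_param => //.
    by apply: scalar_power_mean2_gt0 => //; rewrite t1 (le_trans s0).
  exact: scalar_power_mean2_ge.
- by rewrite /power_mean2 eqxx.
- by rewrite /power_mean2 oner_eq0 eqxx.
- by move=> mn; apply: power_mean2_increasing => //; apply: le_param.
- by move=> nm; apply: power_mean2_decreasing => //; apply: le_param.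
Qed.
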